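(* Let $1<p<\infty$, and suppose that $f\in H^p$ satisfies $f(0)\neq 0$. If $\lambda = q_{0,p}[f]$, then \[ |\lambda| \leq \frac{1}{K_1^{1/r}\big[\|f-f(0)\|_p^r + \|f\|_p^r\big]^{1/r}}, \] where $r$ and $K_1$ are the lower Pythagorean parameters.
   Context: $H^p$ denotes the classical Hardy space of holomorphic functions on the open unit disk $\mathbb{D}$, with norm $\|f\|_p = \left(\sup_{0\le \rho<1}\frac{1}{2\pi}\int_0^{2\pi}|f(\rho e^{i\theta})|^p\,d\theta\right)^{1/p}$. For an integer $n\ge 0$ let $\mathcal{P}_n$ be the set of complex polynomials of degree at most $n$. For $1<p<\infty$ and $f\in H^p$, not identically zero, the $n$-th optimal polynomial approximant (OPA) to $1/f$ in $H^p$, denoted $q_{n,p}[f]$, is the unique polynomial $q\in\mathcal{P}_n$ minimizing $\|1-qf\|_p$ over $\mathcal{P}_n$; in particular $q_{0,p}[f]$ is a complex constant. The lower Pythagorean parameters are: $r=2$, $K_1=p-1$ if $1<p\le 2$; and $r=p$, $K_1=\frac{1}{2^{p-1}-1}$ if $2\le p<\infty$. (They are the parameters for which $\|x+y\|_p^r\ge \|x\|_p^r+K_1\|y\|_p^r$ whenever $x\perp_p y$ in $L^p$, where $x\perp_p y$ means $\|x+\beta y\|_p\ge\|x\|_p$ for all scalars $\beta$.) *)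

(* Defs.v *)
From Stdlib Require Import Reals.
From Coquelicot Require Import Coquelicot.
Open Scope R_scope.

(* x^a for x >= 0 and a > 0.  Rpower cannot be used directly at x = 0, since
   ln 0 = 0 in the standard library makes Rpower 0 a = 1. *)
Definition rpow (x a : R) : R :=
  if Req_EM_T x 0 then 0 else Rpower x a.

Definition cpolar (rho theta : R) : C := (rho * cos theta, rho * sin theta).

(* Functions on the disk are total functions C -> C whose values outside the
   disk never matter. *)
Definition holomorphic_disk (f : C -> C) : Prop :=
  forall z : C, Cmod z < 1 -> @ex_derive C_AbsRing C_NormedModule f z.

Definition Hardy_mean (p : R) (f : C -> C) (rho : R) : R :=
  / (2 * PI) *
  RInt (fun theta : R => rpow (Cmod (f (cpolar rho theta))) p) 0 (2 * PI).

Definition Hardy_sup (p : R) (f : C -> C) : Rbar :=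
  Lub_Rbar (fun m : R => exists rho : R, 0 <= rho < 1 /\ m = Hardy_mean p f rho).

(* real sends infinities to 0, so Hp_norm is meaningful only for f in H^p. *)
Definition Hp_norm (p : R) (f : C -> C) : R :=
  rpow (real (Hardy_sup p f)) (1 / p).

Definition in_Hp (p : R) (f : C -> C) : Prop :=
  holomorphic_disk f /\ is_finite (Hardy_sup p f).

Definition poly_deg_le (n : nat) (q : C -> C) : Prop :=
  exists a : nat -> C, forall z : C,
    q z = sum_n (fun k : nat => Cmult (a k) (Cpow z k)) n.

(* q = q_{n,p}[f], as a relation: q minimizes ||1 - q f||_p over P_n. *)
Definition is_OPA (n : nat) (p : R) (f q : C -> C) : Prop :=
  poly_deg_le n q /\
  forall q' : C -> C, poly_deg_le n q' ->
    Hp_norm p (fun z : C => Cminus (RtoC 1) (Cmult (q z) (f z))) <=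
    Hp_norm p (fun z : C => Cminus (RtoC 1) (Cmult (q' z) (f z))).

Definition lower_r (p : R) : R := if Rle_dec p 2 then 2 else p.

Definition lower_K1 (p : R) : R :=
  if Rle_dec p 2 then p - 1 else 1 / (Rpower 2 (p - 1) - 1).

(* Main.v *)
Require Import Defs.
From Stdlib Require Import Reals Lra Lia ClassicalEpsilon FunctionalExtensionality.
From Coquelicot Require Import Coquelicot.
Open Scope R_scope.

(** The bound is two applications of the Pythagorean inequality
      ||x + y||^r >= ||x||^r + K1 ||y||^r   for x orthogonal to y
    in the sense of Birkhoff and James ([Hardy_pythagorean]).  Minimality of lambda says that
    1 - lambda f is orthogonal to f, so with x = 1 - lambda f and y = lambda f
      1 >= ||1 - lambda f||^r + K1 |lambda|^r ||f||^r.
    A constant is orthogonal to every function vanishing at 0, because |h(0)| <= ||h||; so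
    with x = 1 - lambda f(0) and y = - lambda (f - f(0))
      ||1 - lambda f||^r >= K1 |lambda|^r ||f - f(0)||^r.
    Adding the two and solving for |lambda| gives the claim.

    The Pythagorean inequality comes from uniform convexity of the norm,
      ||m||^r + kappa ||d||^r <= (||m + d||^r + ||m - d||^r) / 2,
    by comparing x + t y with x + (t/2) y and iterating ([halving_growth]); summing the
    geometric series of the gains turns kappa into K1 = kappa / (2^(r-1) - 1).  On a single
    circle uniform convexity ([Lp_uniform_convexity]) is Clarkson's inequality when p >= 2,
    with kappa = 1, and the inequality of Ball, Carlen and Lieb when p <= 2, with kappa = p - 1.

    The norm is a supremum over circles and no boundary values are used.  Carrying uniform
    convexity over to the supremum requires that the circle means increase with the
    radius ([Hardy_mean_nondecreasing]), and the orthogonality of constants requires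
    |f(0)|^p to be at most every circle mean ([submean_Hardy]).  Both follow from the mean
    value property, applied to f composed with dilations, rotations and Möbius maps.  As
    holomorphy means only that complex derivatives exist, the mean value property rests on
    Goursat's bisection argument ([goursat_rectangle]). *)

(** * Goursat's theorem for real differential forms on a rectangle *)

Lemma pow2_gt0 (n : nat) : 0 < 2 ^ n.
Proof. apply pow_lt; lra. Qed.

Lemma halving_sequence_bounds (x : nat -> R) (L : R) :
  (forall n, x (S n) = x n \/ x (S n) = x n + L / 2 ^ S n) ->
  0 <= L ->
  exists c, forall n, x n <= c <= x n + L / 2 ^ n.
Proof.
intros Hstep HL.
assert (Hpos : forall n, 0 <= L / 2 ^ n).
{ intro n. apply Rdiv_le_0_compat; [lra | apply pow2_gt0]. }
assert (Hhalf : forall n, L / 2 ^ n = 2 * (L / 2 ^ S n)).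
{ intro n. simpl. field. generalize (pow2_gt0 n); lra. }
assert (Hinc : forall n, x n <= x (S n)).
{ intro n. destruct (Hstep n) as [E | E]; rewrite E; generalize (Hpos (S n)); lra. }
assert (Hdec : forall n, x (S n) + L / 2 ^ S n <= x n + L / 2 ^ n).
{ intro n. rewrite (Hhalf n).
  destruct (Hstep n) as [E | E]; rewrite E; generalize (Hpos (S n)); lra. }
assert (Hle : forall n k, x n <= x (n + k)%nat /\
                x (n + k)%nat + L / 2 ^ (n + k) <= x n + L / 2 ^ n).
{ intros n k; induction k as [|k [IH1 IH2]].
  - rewrite Nat.add_0_r; lra.
  - rewrite Nat.add_succ_r.
    specialize (Hinc (n + k)%nat). specialize (Hdec (n + k)%nat). lra. }
assert (Hbd : bound (fun v => exists n, v = x n)).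
{ exists (x 0%nat + L / 2 ^ 0). intros v [n ->].
  generalize (Hle 0%nat n); intros [_ H]. generalize (Hpos n).
  change (0 + n)%nat with n in H. lra. }
destruct (completeness _ Hbd) as [c [Hub Hlub]].
{ exists (x 0%nat). now exists 0%nat. }
exists c. intro n; split.
- apply Hub. now exists n.
- apply Hlub. intros v [m ->].
  destruct (Nat.le_ge_cases n m) as [Hnm | Hmn].
  + replace m with (n + (m - n))%nat by lia.
    generalize (Hle n (m - n)%nat) (Hpos (n + (m - n))%nat). lra.
  + generalize (Hle m (n - m)%nat).
    replace (m + (n - m))%nat with n by lia. generalize (Hpos n). lra.
Qed.

(** Nested bisection, stated for an arbitrary property of cells so that no functional
    on rectangles is built into it.  If the root cell were bad, some quarter of every
    bad cell would be bad, and the chosen corners converge to a point near which the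
    local hypothesis fails. *)
Lemma bisection_principle (good : nat -> R -> R -> Prop) (a b L H : R) :
  0 <= L -> 0 <= H ->
  (forall n x y,
     good (S n) x y -> good (S n) (x + L / 2 ^ S n) y ->
     good (S n) x (y + H / 2 ^ S n) ->
     good (S n) (x + L / 2 ^ S n) (y + H / 2 ^ S n) -> good n x y) ->
  (forall cx cy, a <= cx <= a + L -> b <= cy <= b + H ->
     exists n, forall x y, x <= cx <= x + L / 2 ^ n -> y <= cy <= y + H / 2 ^ n ->
       good n x y) ->
  good 0%nat a b.
Proof.
intros HL HH Hsplit Hlocal.
apply NNPP; intro Hbad.
assert (Hchild : forall n (z : R * R), { z' : R * R |
   ~ good n (fst z) (snd z) ->
   ~ good (S n) (fst z') (snd z') /\
   (fst z' = fst z \/ fst z' = fst z + L / 2 ^ S n) /\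
   (snd z' = snd z \/ snd z' = snd z + H / 2 ^ S n) }).
{ intros n [x y]. apply constructive_indefinite_description. cbn [fst snd].
  destruct (classic (good n x y)) as [Hg | Hg]; [exists (x, y); tauto |].
  destruct (classic (good (S n) x y)) as [H1 | H1];
    [| exists (x, y); cbn [fst snd]; tauto].
  destruct (classic (good (S n) (x + L / 2 ^ S n) y)) as [H2 | H2];
    [| exists (x + L / 2 ^ S n, y); cbn [fst snd]; tauto].
  destruct (classic (good (S n) x (y + H / 2 ^ S n))) as [H3 | H3];
    [| exists (x, y + H / 2 ^ S n); cbn [fst snd]; tauto].
  exists (x + L / 2 ^ S n, y + H / 2 ^ S n); cbn [fst snd]; intros _.
  split; [| tauto]. intro H4; apply Hg, Hsplit; assumption. }
pose (s := fix s n := match n with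
                      | O => (a, b)
                      | S m => proj1_sig (Hchild m (s m)) end).
assert (Hs : forall n, ~ good n (fst (s n)) (snd (s n))).
{ induction n as [|n IH]; [exact Hbad |].
  simpl. destruct (Hchild n (s n)) as [z' Hz']; cbn [proj1_sig]. tauto. }
destruct (halving_sequence_bounds (fun n => fst (s n)) L) as [cx Hcx]; auto.
{ intro n. simpl. destruct (Hchild n (s n)) as [z' Hz']; cbn [proj1_sig].
  specialize (Hz' (Hs n)). tauto. }
destruct (halving_sequence_bounds (fun n => snd (s n)) H) as [cy Hcy]; auto.
{ intro n. simpl. destruct (Hchild n (s n)) as [z' Hz']; cbn [proj1_sig].
  specialize (Hz' (Hs n)). tauto. }
destruct (Hlocal cx cy) as [n Hn].
- generalize (Hcx 0%nat). simpl. lra.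
- generalize (Hcy 0%nat). simpl. lra.
- apply (Hs n), Hn; auto.
Qed.

(** The integral of P dx + Q dy counterclockwise around the boundary of the rectangle. *)
Definition circulation (P Q : R -> R -> R) (x0 x1 y0 y1 : R) : R :=
  RInt (fun x => P x y0 - P x y1) x0 x1 + RInt (fun y => Q x1 y - Q x0 y) y0 y1.

(** Fréchet differentiability of both coefficients with equal cross derivatives, at one
    point only: nothing is assumed about continuity of the derivatives, because
    holomorphy provides none before a theorem of Goursat type is available. *)
Definition closed_form_at (P Q : R -> R -> R) (x y : R) : Prop :=
  exists px l qy, differentiable_pt_lim P x y px l /\
                  differentiable_pt_lim Q x y l qy.

Lemma differentiable_pt_lim_continuous (F : R -> R -> R) x y lx ly :
  differentiable_pt_lim F x y lx ly ->
  continuous (fun z : R * R => F (fst z) (snd z)) (x, y).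
Proof.
intro Hd. apply continuity_2d_pt_filterlim, differentiable_continuity_pt.
now exists lx, ly.
Qed.

Lemma closed_form_continuous P Q x y :
  closed_form_at P Q x y ->
  (continuous (fun x' => P x' y) x /\ continuous (fun y' => P x y') y) /\
  (continuous (fun x' => Q x' y) x /\ continuous (fun y' => Q x y') y).
Proof.
intros (px & l & qy & HP & HQ).
apply differentiable_pt_lim_continuous in HP.
apply differentiable_pt_lim_continuous in HQ.
repeat split.
- exact (continuous_comp_2 (fun x' : R => x') (fun _ => y) P x
           (continuous_id _) (continuous_const _ _) HP).
- exact (continuous_comp_2 (fun _ => x) (fun y' : R => y') P y
           (continuous_const _ _) (continuous_id _) HP).
- exact (continuous_comp_2 (fun x' : R => x') (fun _ => y) Q x
           (continuous_id _) (continuous_const _ _) HQ).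
- exact (continuous_comp_2 (fun _ => x) (fun y' : R => y') Q y
           (continuous_const _ _) (continuous_id _) HQ).
Qed.

Lemma ex_RInt_closed_form P Q x0 x1 y0 y1 :
  x0 <= x1 -> y0 <= y1 ->
  (forall x y, x0 <= x <= x1 -> y0 <= y <= y1 -> closed_form_at P Q x y) ->
  (forall y, y0 <= y <= y1 -> ex_RInt (fun x => P x y) x0 x1) /\
  (forall x, x0 <= x <= x1 -> ex_RInt (fun y => Q x y) y0 y1).
Proof.
intros Hx Hy Hc; split.
- intros y Hyy. apply (ex_RInt_continuous (V := R_CompleteNormedModule)). intros x Hxx.
  rewrite Rmin_left, Rmax_right in Hxx by assumption.
  now destruct (closed_form_continuous _ _ _ _ (Hc x y Hxx Hyy)) as [[] []].
- intros x Hxx. apply (ex_RInt_continuous (V := R_CompleteNormedModule)). intros y Hyy.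
  rewrite Rmin_left, Rmax_right in Hyy by assumption.
  now destruct (closed_form_continuous _ _ _ _ (Hc x y Hxx Hyy)) as [[] []].
Qed.

Lemma RInt_near_const (f : R -> R) (a b c M : R) :
  a <= b -> ex_RInt f a b ->
  (forall t, a <= t <= b -> Rabs (f t - c) <= M) ->
  Rabs (RInt f a b - c * (b - a)) <= (b - a) * M.
Proof.
intros Hab Hf HM.
assert (Hc : ex_RInt (fun _ : R => c) a b) by apply ex_RInt_const.
replace (RInt f a b - c * (b - a)) with (RInt (fun t => f t - c) a b).
- apply abs_RInt_le_const; auto. now apply (ex_RInt_minus (V := R_NormedModule)).
- transitivity (minus (RInt f a b) (RInt (fun _ : R => c) a b)).
  + now apply (RInt_minus (V := R_CompleteNormedModule)).
  + rewrite RInt_const. unfold minus, plus, opp, scal; simpl.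
    unfold mult; simpl. ring.
Qed.

(** The affine parts of P and Q at (cx, cy) have zero circulation, since the cross
    derivatives agree; only the first-order remainder, at most eps D along a boundary of
    length at most 4 D, contributes.  The point must lie in the rectangle for the
    remainder to be controlled by the size of the rectangle. *)
Lemma circulation_local (P Q : R -> R -> R) (cx cy : R) (eps : posreal) :
  closed_form_at P Q cx cy ->
  exists delta : posreal, forall x0 x1 y0 y1 D,
    x0 <= cx <= x1 -> y0 <= cy <= y1 ->
    x1 - x0 <= D -> y1 - y0 <= D -> D < delta ->
    (forall x y, x0 <= x <= x1 -> y0 <= y <= y1 -> closed_form_at P Q x y) ->
    Rabs (circulation P Q x0 x1 y0 y1) <= 4 * eps * D ^ 2.
Proof.
intros (px & l & qy & HP & HQ).
destruct (HP eps) as [d1 H1]. destruct (HQ eps) as [d2 H2].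
exists (mkposreal _ (Rmin_stable_in_posreal d1 d2)); simpl.
intros x0 x1 y0 y1 D Hcx Hcy Hx Hy HD Hc.
assert (HD1 : D < d1) by (eapply Rlt_le_trans; [exact HD | apply Rmin_l]).
assert (HD2 : D < d2) by (eapply Rlt_le_trans; [exact HD | apply Rmin_r]).
clear HD.
destruct (ex_RInt_closed_form P Q x0 x1 y0 y1) as [IP IQ]; [lra | lra | auto |].
assert (Hin : forall x y, x0 <= x <= x1 -> y0 <= y <= y1 ->
   Rabs (x - cx) <= D /\ Rabs (y - cy) <= D).
{ intros x y Hxx Hyy; split; apply Rabs_le; lra. }
assert (EP : forall x y, x0 <= x <= x1 -> y0 <= y <= y1 ->
   Rabs (P x y - P cx cy - (px * (x - cx) + l * (y - cy))) <= eps * D).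
{ intros x y Hxx Hyy. destruct (Hin x y Hxx Hyy).
  eapply Rle_trans; [apply H1; lra |].
  apply Rmult_le_compat_l; [apply Rlt_le, cond_pos | now apply Rmax_lub]. }
assert (EQ : forall x y, x0 <= x <= x1 -> y0 <= y <= y1 ->
   Rabs (Q x y - Q cx cy - (l * (x - cx) + qy * (y - cy))) <= eps * D).
{ intros x y Hxx Hyy. destruct (Hin x y Hxx Hyy).
  eapply Rle_trans; [apply H2; lra |].
  apply Rmult_le_compat_l; [apply Rlt_le, cond_pos | now apply Rmax_lub]. }
assert (BP : Rabs (RInt (fun x => P x y0 - P x y1) x0 x1 - (- l * (y1 - y0)) * (x1 - x0))
             <= (x1 - x0) * (2 * (eps * D))).
{ apply RInt_near_const; [lra | |].
  - apply (ex_RInt_minus (V := R_NormedModule)); apply IP; lra.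
  - intros t Ht.
    generalize (EP t y0 Ht ltac:(lra)) (EP t y1 Ht ltac:(lra)). intros A B.
    apply Rabs_le_between in A. apply Rabs_le_between in B.
    apply Rabs_le; lra. }
assert (BQ : Rabs (RInt (fun y => Q x1 y - Q x0 y) y0 y1 - (l * (x1 - x0)) * (y1 - y0))
             <= (y1 - y0) * (2 * (eps * D))).
{ apply RInt_near_const; [lra | |].
  - apply (ex_RInt_minus (V := R_NormedModule)); apply IQ; lra.
  - intros t Ht.
    generalize (EQ x0 t ltac:(lra) Ht) (EQ x1 t ltac:(lra) Ht). intros A B.
    apply Rabs_le_between in A. apply Rabs_le_between in B.
    apply Rabs_le; lra. }
unfold circulation.
assert (HeD : 0 <= 2 * (eps * D)).
{ generalize (cond_pos eps); intro. assert (0 <= eps * D) by (apply Rmult_le_pos; lra). lra. }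
assert ((x1 - x0) * (2 * (eps * D)) <= D * (2 * (eps * D))) by (apply Rmult_le_compat_r; lra).
assert ((y1 - y0) * (2 * (eps * D)) <= D * (2 * (eps * D))) by (apply Rmult_le_compat_r; lra).
apply Rabs_le_between in BP. apply Rabs_le_between in BQ.
replace (4 * eps * D ^ 2) with (D * (2 * (eps * D)) + D * (2 * (eps * D))) by ring.
apply Rabs_le. lra.
Qed.

Lemma RInt_split (f : R -> R) a b c :
  a <= b <= c -> ex_RInt f a c -> RInt f a c = RInt f a b + RInt f b c.
Proof.
intros Hb Hf. symmetry. apply (RInt_Chasles (V := R_CompleteNormedModule)).
- now apply (ex_RInt_Chasles_1 (V := R_CompleteNormedModule)) with (c := c).
- now apply (ex_RInt_Chasles_2 (V := R_CompleteNormedModule)) with (a := a).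
Qed.

Lemma RInt_sub (f g : R -> R) a b :
  ex_RInt f a b -> ex_RInt g a b ->
  RInt (fun t => f t - g t) a b = RInt f a b - RInt g a b.
Proof. apply (RInt_minus (V := R_CompleteNormedModule)). Qed.

Lemma circulation_split P Q x0 xm x1 y0 ym y1 :
  x0 <= xm <= x1 -> y0 <= ym <= y1 ->
  (forall x y, x0 <= x <= x1 -> y0 <= y <= y1 -> closed_form_at P Q x y) ->
  circulation P Q x0 x1 y0 y1 =
  circulation P Q x0 xm y0 ym + circulation P Q xm x1 y0 ym +
  circulation P Q x0 xm ym y1 + circulation P Q xm x1 ym y1.
Proof.
intros Hx Hy Hc.
destruct (ex_RInt_closed_form P Q x0 x1 y0 y1) as [IP IQ]; [lra | lra | auto |].
destruct (ex_RInt_closed_form P Q x0 xm y0 y1) as [IP1 _]; [lra | lra | intros; apply Hc; lra |].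
destruct (ex_RInt_closed_form P Q xm x1 y0 y1) as [IP2 _]; [lra | lra | intros; apply Hc; lra |].
destruct (ex_RInt_closed_form P Q x0 x1 y0 ym) as [_ IQ1]; [lra | lra | intros; apply Hc; lra |].
destruct (ex_RInt_closed_form P Q x0 x1 ym y1) as [_ IQ2]; [lra | lra | intros; apply Hc; lra |].
unfold circulation.
repeat rewrite RInt_sub by
 (solve [apply IP; lra | apply IP1; lra | apply IP2; lra
        | apply IQ; lra | apply IQ1; lra | apply IQ2; lra]).
rewrite (RInt_split (fun x => P x y0) x0 xm x1), (RInt_split (fun x => P x y1) x0 xm x1),
  (RInt_split (Q x0) y0 ym y1), (RInt_split (Q x1) y0 ym y1);
  try lra; try (apply IP; lra); try (apply IQ; lra).
Qed.

(** Cells at depth n have sides of order 2^-n, so the local bound is of order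
    eps 4^-n, while the circulation is additive under cutting into four: a bound
    eta / 4^n on the cells therefore propagates up to the bound eta on the whole. *)
Theorem goursat_rectangle P Q x0 x1 y0 y1 :
  x0 <= x1 -> y0 <= y1 ->
  (forall x y, x0 <= x <= x1 -> y0 <= y <= y1 -> closed_form_at P Q x y) ->
  circulation P Q x0 x1 y0 y1 = 0.
Proof.
intros Hx Hy Hc.
set (L := x1 - x0). set (H := y1 - y0).
assert (HL : 0 <= L) by (unfold L; lra). assert (HH : 0 <= H) by (unfold H; lra).
assert (Hsmall : forall eta : posreal, Rabs (circulation P Q x0 x1 y0 y1) <= eta).
{ intro eta.
  set (D := L + H + 1).
  assert (HD : 0 < D) by (unfold D; lra).
  assert (Hgood := bisection_principle
    (fun n x y => x0 <= x -> x + L / 2 ^ n <= x1 -> y0 <= y -> y + H / 2 ^ n <= y1 ->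
       Rabs (circulation P Q x (x + L / 2 ^ n) y (y + H / 2 ^ n)) <= eta / 4 ^ n)
    x0 y0 L H HL HH).
  cbv beta in Hgood.
  replace x1 with (x0 + L / 2 ^ 0) by (unfold L; simpl; field).
  replace y1 with (y0 + H / 2 ^ 0) by (unfold H; simpl; field).
  replace (pos eta) with (eta / 4 ^ 0) by (simpl; field).
  apply Hgood; clear Hgood; try (unfold L, H; simpl; lra).
  - intros n x y G1 G2 G3 G4 A1 A2 A3 A4.
    assert (EL : L / 2 ^ n = L / 2 ^ S n + L / 2 ^ S n).
    { simpl. field. generalize (pow2_gt0 n); lra. }
    assert (EH : H / 2 ^ n = H / 2 ^ S n + H / 2 ^ S n).
    { simpl. field. generalize (pow2_gt0 n); lra. }
    assert (PL : 0 <= L / 2 ^ S n) by (apply Rdiv_le_0_compat; [lra | apply pow2_gt0]).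
    assert (PH : 0 <= H / 2 ^ S n) by (apply Rdiv_le_0_compat; [lra | apply pow2_gt0]).
    rewrite EL, EH in *. rewrite <- !Rplus_assoc in *.
    rewrite (circulation_split _ _ x (x + L / 2 ^ S n) _ y (y + H / 2 ^ S n)) by
      (try lra; intros; apply Hc; lra).
    specialize (G1 ltac:(lra) ltac:(lra) ltac:(lra) ltac:(lra)).
    specialize (G2 ltac:(lra) ltac:(lra) ltac:(lra) ltac:(lra)).
    specialize (G3 ltac:(lra) ltac:(lra) ltac:(lra) ltac:(lra)).
    specialize (G4 ltac:(lra) ltac:(lra) ltac:(lra) ltac:(lra)).
    replace (eta / 4 ^ n) with (4 * (eta / 4 ^ S n)).
    2: { simpl. field. apply pow_nonzero; lra. }
    apply Rabs_le_between in G1. apply Rabs_le_between in G2.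
    apply Rabs_le_between in G3. apply Rabs_le_between in G4.
    apply Rabs_le. lra.
  - intros cx cy Hcx Hcy.
    assert (He : 0 < eta / (4 * D ^ 2)).
    { apply Rdiv_lt_0_compat; [apply cond_pos |]. apply Rmult_lt_0_compat; [lra |].
      now apply pow_lt. }
    destruct (circulation_local P Q cx cy (mkposreal _ He)) as [delta Hdelta].
    { apply Hc; unfold L, H in *; lra. }
    assert (Hn : exists n, D / 2 ^ n < delta).
    { destruct (pow_lt_1_zero (1 / 2) ltac:(rewrite Rabs_pos_eq; lra) (delta / D)
        ltac:(apply Rdiv_lt_0_compat; [apply cond_pos | lra])) as [N HN].
      exists N. specialize (HN N (Nat.le_refl N)).
      rewrite Rabs_pos_eq in HN by (apply pow_le; lra).
      replace (D / 2 ^ N) with (D * (1 / 2) ^ N).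
      2: { unfold Rdiv. rewrite Rmult_1_l, pow_inv. ring. }
      apply (Rmult_lt_compat_l D) in HN; [| lra].
      replace (D * (delta / D)) with (pos delta) in HN by (field; lra). exact HN. }
    destruct Hn as [n Hn]. exists n.
    intros x y Hxx Hyy A1 A2 A3 A4.
    assert (Hpn := pow2_gt0 n).
    eapply Rle_trans.
    + apply (Hdelta _ _ _ _ (D / 2 ^ n)); try lra.
      * replace (x + L / 2 ^ n - x) with (L / 2 ^ n) by ring.
        apply Rmult_le_compat_r; [apply Rlt_le, Rinv_0_lt_compat; lra | unfold D; lra].
      * replace (y + H / 2 ^ n - y) with (H / 2 ^ n) by ring.
        apply Rmult_le_compat_r; [apply Rlt_le, Rinv_0_lt_compat; lra | unfold D; lra].
      * intros; apply Hc; lra.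
    + simpl pos. apply Req_le.
      replace (4 ^ n) with ((2 ^ n) ^ 2).
      * field. lra.
      * rewrite <- pow_mult, Nat.mul_comm, pow_mult. f_equal. ring. }
destruct (Req_dec (circulation P Q x0 x1 y0 y1) 0) as [E | E]; [exact E |].
assert (Hp := Rabs_pos_lt _ E).
generalize (Hsmall (mkposreal (Rabs (circulation P Q x0 x1 y0 y1) / 2) ltac:(lra))).
simpl. lra.
Qed.

(** * Complex differentiability *)

(** The epsilon-delta form of complex differentiability.  It avoids choosing between the
    several uniform structures that C carries (as a product, as an absolute ring). *)
Definition complex_diff (g : C -> C) (z d : C) : Prop :=
  forall eps, 0 < eps -> exists delta, 0 < delta /\
    forall w, Cmod (w - z) < delta ->
      Cmod (g w - g z - d * (w - z)) <= eps * Cmod (w - z).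

Lemma ex_derive_complex_diff (f : C -> C) (z : C) :
  @ex_derive C_AbsRing C_NormedModule f z -> exists d, complex_diff f z d.
Proof.
intros [d [_ Hd]]. exists d. intros eps Heps.
specialize (Hd z (fun P HP => HP) (mkposreal eps Heps)).
destruct Hd as [delta Hdelta]. exists delta; split; [apply cond_pos |].
intros w Hw. specialize (Hdelta w Hw).
rewrite (Cmult_comm d). exact Hdelta.
Qed.

Lemma complex_diff_lipschitz g z d :
  complex_diff g z d -> exists delta, 0 < delta /\
    forall w, Cmod (w - z) < delta -> Cmod (g w - g z) <= (Cmod d + 1) * Cmod (w - z).
Proof.
intro H. destruct (H 1 Rlt_0_1) as (delta & Hdelta & Hw).
exists delta; split; [assumption |]. intros w W. specialize (Hw w W).
replace (g w - g z)%C with ((g w - g z - d * (w - z)) + d * (w - z))%C by ring.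
eapply Rle_trans; [apply Cmod_triangle |]. rewrite Cmod_mult. lra.
Qed.

Lemma complex_diff_comp g h z dg dh :
  complex_diff h z dh -> complex_diff g (h z) dg ->
  complex_diff (fun w => g (h w)) z (dg * dh).
Proof.
intros Hh Hg eps Heps.
destruct (complex_diff_lipschitz _ _ _ Hh) as (d0 & Hd0 & L0).
assert (Md := Cmod_ge_0 dh). assert (Mg := Cmod_ge_0 dg).
destruct (Hg (eps / 2 / (Cmod dh + 1))) as (d1 & Hd1 & L1).
{ apply Rdiv_lt_0_compat; lra. }
destruct (Hh (eps / 2 / (Cmod dg + 1))) as (d2 & Hd2 & L2).
{ apply Rdiv_lt_0_compat; lra. }
exists (Rmin d0 (Rmin d2 (d1 / (Cmod dh + 1)))); split.
{ repeat apply Rmin_glb_lt; try assumption. apply Rdiv_lt_0_compat; lra. }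
intros w Hw.
assert (W0 : Cmod (w - z) < d0) by (eapply Rlt_le_trans; [exact Hw | apply Rmin_l]).
assert (W' : Cmod (w - z) < Rmin d2 (d1 / (Cmod dh + 1)))
  by (eapply Rlt_le_trans; [exact Hw | apply Rmin_r]).
assert (W2 : Cmod (w - z) < d2) by (eapply Rlt_le_trans; [exact W' | apply Rmin_l]).
assert (W1 : Cmod (w - z) < d1 / (Cmod dh + 1))
  by (eapply Rlt_le_trans; [exact W' | apply Rmin_r]).
specialize (L0 w W0). specialize (L2 w W2).
assert (Hh1 : Cmod (h w - h z) < d1).
{ eapply Rle_lt_trans; [exact L0 |].
  apply (Rmult_lt_compat_l (Cmod dh + 1)) in W1; [| lra].
  replace ((Cmod dh + 1) * (d1 / (Cmod dh + 1))) with d1 in W1 by (field; lra). exact W1. }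
specialize (L1 _ Hh1).
replace (g (h w) - g (h z) - dg * dh * (w - z))%C
  with ((g (h w) - g (h z) - dg * (h w - h z)) + dg * (h w - h z - dh * (w - z)))%C by ring.
eapply Rle_trans; [apply Cmod_triangle |]. rewrite Cmod_mult.
assert (A1 : eps / 2 / (Cmod dh + 1) * Cmod (h w - h z) <= eps / 2 * Cmod (w - z)).
{ eapply Rle_trans.
  - apply Rmult_le_compat_l; [| exact L0]. apply Rlt_le, Rdiv_lt_0_compat; lra.
  - apply Req_le. field. lra. }
assert (A2 : Cmod dg * Cmod (h w - h z - dh * (w - z)) <= eps / 2 * Cmod (w - z)).
{ eapply Rle_trans; [apply Rmult_le_compat_l; [exact Mg | exact L2] |].
  replace (Cmod dg * (eps / 2 / (Cmod dg + 1) * Cmod (w - z)))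
    with (Cmod dg / (Cmod dg + 1) * (eps / 2 * Cmod (w - z))) by (field; lra).
  rewrite <- (Rmult_1_l (eps / 2 * Cmod (w - z))) at 2.
  apply Rmult_le_compat_r.
  - apply Rmult_le_pos; [lra | apply Cmod_ge_0].
  - apply Rmult_le_reg_r with (Cmod dg + 1); [lra |].
    unfold Rdiv. rewrite Rmult_assoc, Rinv_l; lra. }
lra.
Qed.

Lemma complex_diff_affine a b g z d :
  complex_diff g z d -> complex_diff (fun w => a + b * g w)%C z (b * d).
Proof.
intros Hg eps Heps.
assert (Mb := Cmod_ge_0 b).
destruct (Hg (eps / (Cmod b + 1))) as (delta & Hdelta & L).
{ apply Rdiv_lt_0_compat; lra. }
exists delta; split; [assumption |]. intros w Hw. specialize (L w Hw).
replace (a + b * g w - (a + b * g z) - b * d * (w - z))%C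
  with (b * (g w - g z - d * (w - z)))%C by ring.
rewrite Cmod_mult.
apply Rle_trans with ((Cmod b + 1) * (eps / (Cmod b + 1) * Cmod (w - z))).
- apply Rmult_le_compat; try lra; try apply Cmod_ge_0.
- apply Req_le. field. lra.
Qed.

Lemma complex_diff_scal c g z d :
  complex_diff g z d -> complex_diff (fun w => c * g w)%C z (c * d).
Proof.
intros Hg eps Heps.
destruct (complex_diff_affine 0 c g z d Hg eps Heps) as (delta & Hdelta & L).
exists delta; split; [assumption |]. intros w Hw. specialize (L w Hw).
now rewrite !Cplus_0_l in L.
Qed.

Lemma complex_diff_id z : complex_diff (fun w => w) z 1.
Proof.
intros eps Heps. exists 1; split; [lra |]. intros w _.
replace (w - z - 1 * (w - z))%C with (RtoC 0) by ring.
rewrite Cmod_0. apply Rmult_le_pos; [lra | apply Cmod_ge_0].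
Qed.

Lemma complex_diff_inv z : z <> RtoC 0 -> complex_diff Cinv z (- / (z * z)).
Proof.
intros Hz eps Heps.
assert (M := proj1 (Cmod_gt_0 z) Hz).
exists (Rmin (Cmod z / 2) (eps * (Cmod z ^ 3 / 2))); split.
{ apply Rmin_glb_lt; [lra |].
  apply Rmult_lt_0_compat; [assumption |]. apply Rdiv_lt_0_compat; [now apply pow_lt | lra]. }
intros w Hw.
assert (W1 : Cmod (w - z) < Cmod z / 2) by (eapply Rlt_le_trans; [exact Hw | apply Rmin_l]).
assert (W2 : Cmod (w - z) < eps * (Cmod z ^ 3 / 2))
  by (eapply Rlt_le_trans; [exact Hw | apply Rmin_r]).
assert (Ww : Cmod z / 2 < Cmod w).
{ assert (T := Cmod_triangle w (z - w)). replace (w + (z - w))%C with z in T by ring.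
  replace (z - w)%C with (- (w - z))%C in T by ring. rewrite Cmod_opp in T. lra. }
assert (Hw0 : w <> RtoC 0) by (apply Cmod_gt_0; lra).
replace (/ w - / z - - / (z * z) * (w - z))%C with ((w - z) * (w - z) / (w * (z * z)))%C
  by (field; split; assumption).
assert (Hzz : (z * z)%C <> RtoC 0) by (apply Cmult_neq_0; assumption).
assert (Hwzz : (w * (z * z))%C <> RtoC 0) by (apply Cmult_neq_0; assumption).
rewrite Cmod_div, !Cmod_mult by assumption.
unfold Rdiv. rewrite Rmult_assoc, (Rmult_comm eps). apply Rmult_le_compat_l; [apply Cmod_ge_0 |].
apply Rmult_le_reg_r with (Cmod w * (Cmod z * Cmod z)).
{ repeat apply Rmult_lt_0_compat; lra. }
rewrite Rmult_assoc, Rinv_l, Rmult_1_r.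
2: { apply Rgt_not_eq. repeat apply Rmult_lt_0_compat; lra. }
apply Rle_trans with (eps * (Cmod z ^ 3 / 2)); [lra |].
apply Rmult_le_compat_l; [lra |].
apply Rle_trans with (Cmod z / 2 * (Cmod z * Cmod z)).
- apply Req_le. field.
- apply Rmult_le_compat_r; [| lra]. apply Rlt_le, Rmult_lt_0_compat; assumption.
Qed.

Lemma complex_diff_continuous (g : C -> C) (z d : C) :
  complex_diff g z d -> continuous g z.
Proof.
intro H. destruct (complex_diff_lipschitz _ _ _ H) as (d0 & Hd0 & L0).
apply filterlim_locally. intro eps.
assert (Md := Cmod_ge_0 d).
assert (Hpos : 0 < Rmin d0 (eps / (Cmod d + 1)) / 2).
{ apply Rdiv_lt_0_compat; [| lra]. apply Rmin_glb_lt; [assumption |].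
  apply Rdiv_lt_0_compat; [apply cond_pos | lra]. }
exists (mkposreal _ Hpos). intros w [W1 W2]. simpl in W1, W2.
assert (Hw : Cmod (w - z) < Rmin d0 (eps / (Cmod d + 1))).
{ eapply Rle_lt_trans; [apply Cmod_2Rmax |].
  set (m := Rmin d0 (eps / (Cmod d + 1))) in *.
  change (Rabs (fst w - fst z) < m / 2) in W1. change (Rabs (snd w - snd z) < m / 2) in W2.
  change (fst (w - z)%C) with (fst w - fst z). change (snd (w - z)%C) with (snd w - snd z).
  assert (Rmax (Rabs (fst w - fst z)) (Rabs (snd w - snd z)) < m / 2)
    by (now apply Rmax_lub_lt).
  assert (sqrt 2 < 2).
  { replace 2 with (sqrt 4) at 2 by (replace 4 with (2 * 2) by ring; apply sqrt_square; lra).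
    apply sqrt_lt_1; lra. }
  assert (0 <= sqrt 2) by apply sqrt_pos.
  assert (0 <= Rmax (Rabs (fst w - fst z)) (Rabs (snd w - snd z)))
    by (eapply Rle_trans; [apply Rabs_pos | apply Rmax_l]).
  nra. }
specialize (L0 w ltac:(eapply Rlt_le_trans; [exact Hw | apply Rmin_l])).
assert (Hg : Cmod (g w - g z) < eps).
{ eapply Rle_lt_trans; [exact L0 |].
  apply Rlt_le_trans with ((Cmod d + 1) * (eps / (Cmod d + 1))).
  - apply Rmult_lt_compat_l; [lra |]. eapply Rlt_le_trans; [exact Hw | apply Rmin_r].
  - apply Req_le. field. lra. }
split.
- change (Rabs (fst (g w - g z)%C) < eps).
  eapply Rle_lt_trans; [| exact Hg]. eapply Rle_trans; [apply Rmax_l | apply Rmax_Cmod].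
- change (Rabs (snd (g w - g z)%C) < eps).
  eapply Rle_lt_trans; [| exact Hg]. eapply Rle_trans; [apply Rmax_r | apply Rmax_Cmod].
Qed.

(** The Cauchy-Riemann equations in the strong form that the rectangle theorem
    consumes: both real components are Fréchet differentiable. *)
Lemma complex_diff_cauchy_riemann (g : C -> C) (x y : R) (d : C) :
  complex_diff g (x, y) d ->
  differentiable_pt_lim (fun x y => fst (g (x, y))) x y (fst d) (- snd d) /\
  differentiable_pt_lim (fun x y => snd (g (x, y))) x y (snd d) (fst d).
Proof.
intro H.
assert (Hs : 0 < sqrt 2) by (apply sqrt_lt_R0; lra).
assert (Hmain : forall eps : posreal, locally_2d (fun u v =>
  Cmod (g (u, v) - g (x, y) - d * ((u, v) - (x, y)))
   <= eps * Rmax (Rabs (u - x)) (Rabs (v - y))) x y).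
{ intro eps. destruct (H (eps / sqrt 2)) as (delta & Hdelta & L).
  { apply Rdiv_lt_0_compat; [apply cond_pos | assumption]. }
  assert (Hp : 0 < delta / sqrt 2) by (apply Rdiv_lt_0_compat; assumption).
  exists (mkposreal _ Hp). intros u v Hu Hv. simpl in Hu, Hv.
  assert (B := Cmod_2Rmax ((u, v) - (x, y))%C).
  change (fst ((u, v) - (x, y))%C) with (u - x) in B.
  change (snd ((u, v) - (x, y))%C) with (v - y) in B.
  eapply Rle_trans; [apply L |].
  - eapply Rle_lt_trans; [exact B |].
    apply Rlt_le_trans with (sqrt 2 * (delta / sqrt 2)).
    + apply Rmult_lt_compat_l; [assumption |]. now apply Rmax_lub_lt.
    + apply Req_le. field. lra.
  - apply Rle_trans with (eps / sqrt 2 * (sqrt 2 * Rmax (Rabs (u - x)) (Rabs (v - y)))).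
    + apply Rmult_le_compat_l; [| exact B]. apply Rlt_le, Rdiv_lt_0_compat;
        [apply cond_pos | assumption].
    + apply Req_le. field. lra. }
split; intro eps; destruct (Hmain eps) as [delta Hd]; exists delta; intros u v Hu Hv;
  (eapply Rle_trans; [| apply Hd; eassumption]).
- eapply Rle_trans; [| eapply Rle_trans; [apply Rmax_l | apply Rmax_Cmod]].
  apply Req_le. f_equal. simpl. ring.
- eapply Rle_trans; [| eapply Rle_trans; [apply Rmax_r | apply Rmax_Cmod]].
  apply Req_le. f_equal. simpl. ring.
Qed.

(** * The exponential map and the mean value property *)

(** The converse direction serves only for the exponential, whose components are products
    of one-variable functions. *)
Lemma cauchy_riemann_complex_diff (g : C -> C) (x y a b : R) :
  differentiable_pt_lim (fun x y => fst (g (x, y))) x y a (- b) ->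
  differentiable_pt_lim (fun x y => snd (g (x, y))) x y b a ->
  complex_diff g (x, y) (a, b).
Proof.
intros Hu Hv eps Heps.
assert (Hs : 0 < sqrt 2) by (apply sqrt_lt_R0; lra).
assert (He : 0 < eps / sqrt 2) by (apply Rdiv_lt_0_compat; assumption).
destruct (Hu (mkposreal _ He)) as [d1 H1]. destruct (Hv (mkposreal _ He)) as [d2 H2].
exists (Rmin d1 d2); split; [apply Rmin_stable_in_posreal |].
intros [u v] Hw.
assert (B := Rmax_Cmod ((u, v) - (x, y))%C).
change (fst ((u, v) - (x, y))%C) with (u - x) in B.
change (snd ((u, v) - (x, y))%C) with (v - y) in B.
assert (B1 := Rle_trans _ _ _ (Rmax_l _ _) B).
assert (B2 := Rle_trans _ _ _ (Rmax_r _ _) B).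
assert (M1 := Rmin_l d1 d2). assert (M2 := Rmin_r d1 d2).
specialize (H1 u v ltac:(lra) ltac:(lra)). specialize (H2 u v ltac:(lra) ltac:(lra)).
simpl pos in H1, H2.
eapply Rle_trans; [apply Cmod_2Rmax |].
apply Rle_trans with (sqrt 2 * (eps / sqrt 2 * Cmod ((u, v) - (x, y)))).
- apply Rmult_le_compat_l; [lra |]. apply Rmax_lub.
  + eapply Rle_trans; [| eapply Rle_trans; [exact H1 |]].
    * apply Req_le. f_equal. simpl. ring.
    * apply Rmult_le_compat_l; [lra | exact B].
  + eapply Rle_trans; [| eapply Rle_trans; [exact H2 |]].
    * apply Req_le. f_equal. simpl. ring.
    * apply Rmult_le_compat_l; [lra | exact B].
- apply Req_le. field. lra.
Qed.

Lemma differentiable_pt_lim_Rmult (x y : R) : differentiable_pt_lim Rmult x y y x.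
Proof.
intro eps. exists eps. intros u v Hu Hv.
replace (u * v - x * y - (y * (u - x) + x * (v - y))) with ((u - x) * (v - y)) by ring.
rewrite Rabs_mult. apply Rmult_le_compat; try apply Rabs_pos; [lra | apply Rmax_r].
Qed.

Lemma differentiable_pt_lim_separate (f g : R -> R) (x y f' g' : R) :
  derivable_pt_lim f x f' -> derivable_pt_lim g y g' ->
  differentiable_pt_lim (fun u v => f u * g v) x y (f' * g y) (f x * g').
Proof.
intros Hf Hg.
assert (Hsnd : differentiable_pt_lim (fun _ v => v) x y 0 1).
{ intro eps. exists eps. intros u v _ _.
  replace (v - y - (0 * (u - x) + 1 * (v - y))) with 0 by ring.
  rewrite Rabs_R0. apply Rmult_le_pos; [apply Rlt_le, cond_pos |].
  eapply Rle_trans; [apply Rabs_pos | apply Rmax_l]. }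
assert (H := differentiable_pt_lim_comp Rmult (fun u _ => f u) (fun _ v => g v) x y _ _ _ _ _ _
  (differentiable_pt_lim_Rmult (f x) (g y))
  (differentiable_pt_lim_proj1_0 f x y f' Hf)
  (differentiable_pt_lim_comp (fun u _ => g u) (fun _ v => v) (fun _ v => v) x y _ _ _ _ _ _
     (differentiable_pt_lim_proj1_0 g y y g' Hg) Hsnd Hsnd)).
cbv beta in H.
replace (f' * g y) with (g y * f' + f x * (g' * 0 + 0 * 0)) by ring.
replace (f x * g') with (g y * 0 + f x * (g' * 1 + 0 * 1)) by ring.
exact H.
Qed.

Definition Cexp (w : C) : C := cpolar (exp (fst w)) (snd w).

Lemma complex_diff_Cexp (w : C) : complex_diff Cexp w (Cexp w).
Proof.
destruct w as [s t]. unfold Cexp at 2, cpolar; cbn [fst snd].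
apply cauchy_riemann_complex_diff; cbn [fst snd Cexp cpolar].
- replace (- (exp s * sin t)) with (exp s * - sin t) by ring.
  apply (differentiable_pt_lim_separate exp cos);
    [apply derivable_pt_lim_exp | apply derivable_pt_lim_cos].
- apply (differentiable_pt_lim_separate exp sin);
    [apply derivable_pt_lim_exp | apply derivable_pt_lim_sin].
Qed.

Lemma Cmod_cpolar rho t : Cmod (cpolar rho t) = Rabs rho.
Proof.
unfold Cmod, cpolar; cbn [fst snd].
replace ((rho * cos t) ^ 2 + (rho * sin t) ^ 2) with (rho²).
- apply sqrt_Rsqr_abs.
- transitivity (rho² * ((sin t)² + (cos t)²)).
  + rewrite sin2_cos2. ring.
  + unfold Rsqr. ring.
Qed.

(** In the coordinate w = s + i t, z = exp w, the function F(w) = g(exp w) is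
    2 pi i-periodic, so on the rectangle [s, 0] x [0, 2 pi] the two horizontal sides of
    the circulation of Im F ds + Re F dt cancel.  Hence the mean of Re g over the circle
    of radius exp s does not depend on s, and s -> -oo gives the value at the centre. *)
Lemma mean_value_unit_circle (g : C -> C) :
  (forall z, Cmod z <= 1 -> exists d, complex_diff g z d) ->
  RInt (fun t => fst (g (cpolar 1 t))) 0 (2 * PI) = 2 * PI * fst (g (RtoC 0)).
Proof.
intro Hg. assert (HPI := PI_RGT_0).
set (J := fun s : R => RInt (fun t => fst (g (cpolar (exp s) t))) 0 (2 * PI) : R).
assert (Hcr : forall s t, s <= 0 -> closed_form_at
  (fun s t => snd (g (cpolar (exp s) t))) (fun s t => fst (g (cpolar (exp s) t))) s t).
{ intros s t Hs. destruct (Hg (cpolar (exp s) t)) as [d Hd].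
  { rewrite Cmod_cpolar, Rabs_pos_eq by (apply Rlt_le, exp_pos).
    rewrite <- exp_0. destruct Hs as [Hs | ->]; [| lra]. now apply Rlt_le, exp_increasing. }
  assert (H := complex_diff_comp g Cexp (s, t) _ _ (complex_diff_Cexp (s, t)) Hd).
  apply complex_diff_cauchy_riemann in H. destruct H as [H1 H2].
  eexists _, _, _. split; [exact H2 | exact H1]. }
assert (HJex : forall s, s <= 0 -> ex_RInt (fun t => fst (g (cpolar (exp s) t))) 0 (2 * PI)).
{ intros s Hs.
  destruct (ex_RInt_closed_form _ _ s s 0 (2 * PI) (Rle_refl s) ltac:(lra)
    (fun x y Hx _ => Hcr x y (Rle_trans _ _ _ (proj2 Hx) Hs))) as [_ H].
  apply (H s); lra. }
assert (HJ : forall s, s <= 0 -> J s = J 0).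
{ intros s Hs.
  assert (H := goursat_rectangle _ _ s 0 0 (2 * PI) Hs ltac:(lra)
                 (fun x y Hx _ => Hcr x y (proj2 Hx))).
  unfold circulation in H. 
  rewrite (RInt_sub (fun t => fst (g (cpolar (exp 0) t)))
             (fun t => fst (g (cpolar (exp s) t)))) in H by (apply HJex; lra).
  change (RInt (fun x => snd (g (cpolar (exp x) 0)) - snd (g (cpolar (exp x) (2 * PI)))) s 0
          + (J 0 - J s) = 0) in H.
  rewrite (RInt_ext _ (fun _ => 0)) in H.
  - rewrite RInt_const in H. unfold scal in H; simpl in H; unfold mult in H; simpl in H. lra.
  - intros x _. unfold cpolar. rewrite cos_2PI, sin_2PI, cos_0, sin_0. apply Rminus_diag. }
assert (Hlim : forall eps : posreal, Rabs (J 0 - 2 * PI * fst (g (RtoC 0))) <= 2 * PI * eps).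
{ intro eps. destruct (Hg (RtoC 0)) as [d Hd]; [rewrite Cmod_0; lra |].
  apply complex_diff_lipschitz in Hd. destruct Hd as (d0 & Hd0 & L).
  assert (Md := Cmod_ge_0 d).
  (* A radius so small that g stays within eps of g(0) on the whole circle. *)
  set (rho := Rmin 1 (Rmin (d0 / 2) (eps / (Cmod d + 1)))).
  assert (Hrho : 0 < rho).
  { unfold rho. repeat apply Rmin_glb_lt; try lra.
    apply Rdiv_lt_0_compat; [apply cond_pos | lra]. }
  assert (R1 : rho <= 1) by apply Rmin_l.
  assert (R2 : rho <= d0 / 2) by (eapply Rle_trans; [apply Rmin_r | apply Rmin_l]).
  assert (R3 : rho <= eps / (Cmod d + 1)) by (eapply Rle_trans; [apply Rmin_r | apply Rmin_r]).
  assert (Hln : ln rho <= 0).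
  { rewrite <- ln_1. destruct R1 as [R1 | ->]; [| lra]. now apply Rlt_le, ln_increasing. }
  rewrite <- (HJ (ln rho) Hln). unfold J.
  assert (B := RInt_near_const (fun t => fst (g (cpolar (exp (ln rho)) t))) 0 (2 * PI)
                 (fst (g (RtoC 0))) eps ltac:(lra) (HJex _ Hln)).
  rewrite Rminus_0_r in B. rewrite (Rmult_comm (2 * PI) (fst _)). apply B.
  intros t _. rewrite exp_ln by assumption.
  assert (E : Cmod (cpolar rho t - 0) = rho).
  { replace (cpolar rho t - 0)%C with (cpolar rho t) by ring.
    rewrite Cmod_cpolar. apply Rabs_pos_eq; lra. }
  specialize (L (cpolar rho t) ltac:(rewrite E; lra)). rewrite E in L.
  eapply Rle_trans; [| eapply Rle_trans; [exact L |]].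
  - change (fst (g (cpolar rho t)) - fst (g (RtoC 0)))
      with (fst (g (cpolar rho t) - g (RtoC 0))%C). apply re_le_Cmod.
  - apply (Rmult_le_compat_l (Cmod d + 1)) in R3; [| lra].
    replace ((Cmod d + 1) * (eps / (Cmod d + 1))) with (pos eps) in R3 by (field; lra). exact R3. }
replace (fun t => fst (g (cpolar 1 t))) with (fun t => fst (g (cpolar (exp 0) t)))
  by (rewrite exp_0; reflexivity).
fold (J 0).
destruct (Req_dec (J 0 - 2 * PI * fst (g (RtoC 0))) 0) as [E | E]; [lra |].
assert (Hp := Rabs_pos_lt _ E).
assert (Hq : 0 < Rabs (J 0 - 2 * PI * fst (g (RtoC 0))) / (4 * PI))
  by (apply Rdiv_lt_0_compat; lra).
specialize (Hlim (mkposreal _ Hq)). simpl in Hlim.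
replace (2 * PI * (Rabs (J 0 - 2 * PI * fst (g (RtoC 0))) / (4 * PI)))
  with (Rabs (J 0 - 2 * PI * fst (g (RtoC 0))) / 2) in Hlim by (field; lra).
lra.
Qed.

(** * Powers and two-point inequalities *)

Lemma rpow_0 a : rpow 0 a = 0.
Proof. unfold rpow. now destruct (Req_EM_T 0 0). Qed.

Lemma rpow_Rpower x a : 0 < x -> rpow x a = Rpower x a.
Proof. intro Hx. unfold rpow. destruct (Req_EM_T x 0); [lra | reflexivity]. Qed.

Lemma rpow_gt0 x a : 0 < x -> 0 < rpow x a.
Proof. intro Hx. rewrite rpow_Rpower by assumption. apply exp_pos. Qed.

Lemma rpow_ge0 x a : 0 <= rpow x a.
Proof. unfold rpow. destruct (Req_EM_T x 0); [lra | apply Rlt_le, exp_pos]. Qed.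

Lemma rpow_1_l a : rpow 1 a = 1.
Proof.
rewrite rpow_Rpower by lra. unfold Rpower. now rewrite ln_1, Rmult_0_r, exp_0.
Qed.

Lemma rpow_1_r x : 0 <= x -> rpow x 1 = x.
Proof.
intros [Hx | <-]; [| apply rpow_0]. rewrite rpow_Rpower by assumption. now apply Rpower_1.
Qed.

Lemma rpow_mult x y a : 0 <= x -> 0 <= y -> rpow (x * y) a = rpow x a * rpow y a.
Proof.
intros [Hx | <-]; [| intros _; rewrite Rmult_0_l, rpow_0; ring].
intros [Hy | <-]; [| rewrite Rmult_0_r, rpow_0; ring].
rewrite !rpow_Rpower by (try assumption; now apply Rmult_lt_0_compat).
symmetry. now apply Rpower_mult_distr.
Qed.

Lemma rpow_rpow x a b : 0 <= x -> rpow (rpow x a) b = rpow x (a * b).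
Proof.
intros [Hx | <-]; [| now rewrite !rpow_0].
rewrite (rpow_Rpower (rpow x a)) by now apply rpow_gt0.
rewrite !rpow_Rpower by assumption. apply Rpower_mult.
Qed.

Lemma rpow_plus x a b : 0 <= x -> rpow x (a + b) = rpow x a * rpow x b.
Proof.
intros [Hx | <-]; [| rewrite !rpow_0; ring].
rewrite !rpow_Rpower by assumption. apply Rpower_plus.
Qed.

Lemma rpow_2 x : 0 <= x -> rpow x 2 = x ^ 2.
Proof.
intro Hx. replace 2 with (1 + 1) by ring.
rewrite rpow_plus, rpow_1_r by assumption. ring.
Qed.

Lemma rpow_le x y a : 0 <= a -> 0 <= x <= y -> rpow x a <= rpow y a.
Proof.
intros Ha [[Hx | <-] Hxy]; [| rewrite rpow_0; apply rpow_ge0].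
rewrite !rpow_Rpower by lra. now apply Rle_Rpower_l; [| split].
Qed.

Lemma rpow_inv_le x y a : 0 < a -> 0 <= x -> 0 <= y -> rpow x a <= y -> x <= rpow y (/ a).
Proof.
intros Ha Hx Hy H.
replace x with (rpow (rpow x a) (/ a)) by (rewrite rpow_rpow, Rinv_r, rpow_1_r; lra).
apply rpow_le; [now apply Rlt_le, Rinv_0_lt_compat | split; [apply rpow_ge0 | assumption]].
Qed.

(** The absolute value removes the jump of rpow at 0 from the left, where the
    convention ln x = 0 for x <= 0 gives the value 1. *)
Lemma continuous_rpow_Rabs a x : 0 < a -> continuous (fun u => rpow (Rabs u) a) x.
Proof.
intro Ha.
destruct (Req_dec x 0) as [-> | Hx].
- apply filterlim_locally. intro eps.
  exists (mkposreal _ (rpow_gt0 eps (/ a) (cond_pos eps))). intros u Hu.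
  change (Rabs (u - 0) < rpow eps (/ a)) in Hu. rewrite Rminus_0_r in Hu.
  change (Rabs (rpow (Rabs u) a - rpow (Rabs 0) a) < eps).
  rewrite Rabs_R0, rpow_0, Rminus_0_r, Rabs_pos_eq by apply rpow_ge0.
  apply Rnot_le_lt. intro H.
  assert (H' : rpow eps (/ a) <= rpow (rpow (Rabs u) a) (/ a)).
  { apply rpow_le; [now apply Rlt_le, Rinv_0_lt_compat |].
    split; [apply Rlt_le, cond_pos | assumption]. }
  rewrite rpow_rpow, Rinv_r, rpow_1_r in H'; try lra; apply Rabs_pos.
- apply (continuous_ext_loc _ (fun u => exp (a * ln (Rabs u)))).
  + exists (mkposreal _ (Rabs_pos_lt _ Hx)). intros u Hu.
    change (Rabs (u - x) < Rabs x) in Hu.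
    rewrite rpow_Rpower; [reflexivity |]. apply Rabs_pos_lt. intros ->.
    rewrite Rminus_0_l, Rabs_Ropp in Hu. lra.
  + apply (ex_derive_continuous (K := R_AbsRing) (V := R_NormedModule)
             (fun u => exp (a * ln (Rabs u)))).
    auto_derive. split; [assumption |]. split; [now apply Rabs_pos_lt | exact I].
Qed.

Lemma exp_above_tangent u w : exp w * (1 + (u - w)) <= exp u.
Proof.
replace u with (w + (u - w)) at 2 by ring. rewrite exp_plus.
apply Rmult_le_compat_l; [apply Rlt_le, exp_pos | apply exp_ineq1_le].
Qed.

(** Convexity of exp along the segment from 0 to p ln x, which contains ln x. *)
Lemma bernoulli_rpow p x : 1 <= p -> 0 <= x -> 1 + p * (x - 1) <= rpow x p.
Proof.
intros Hp [Hx | <-]; [| rewrite rpow_0; lra].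
rewrite rpow_Rpower by assumption. unfold Rpower.
assert (H1 := exp_above_tangent (p * ln x) (ln x)).
assert (H0 := exp_above_tangent 0 (ln x)).
rewrite exp_ln in * by assumption. rewrite exp_0 in H0. nra.
Qed.

Lemma rpow_above_tangent p x c :
  1 <= p -> 0 <= x -> 0 <= c -> rpow c p + p * rpow c (p - 1) * (x - c) <= rpow x p.
Proof.
intros Hp Hx [Hc | <-].
- assert (B := bernoulli_rpow p (x / c) Hp (Rdiv_le_0_compat _ _ Hx Hc)).
  apply (Rmult_le_compat_l (rpow c p)) in B; [| apply rpow_ge0].
  rewrite <- rpow_mult in B by (try lra; now apply Rdiv_le_0_compat).
  replace (c * (x / c)) with x in B by (field; lra).
  eapply Rle_trans; [| exact B]. apply Req_le.
  replace (rpow c p) with (rpow c (p - 1) * c).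
  + field. lra.
  + rewrite <- (rpow_1_r c) at 2 by lra. rewrite <- rpow_plus by lra. f_equal. ring.
- rewrite !rpow_0. generalize (rpow_ge0 x p). lra.
Qed.

Lemma rpow_midpoint_convex p x y :
  1 <= p -> 0 <= x -> 0 <= y -> rpow ((x + y) / 2) p <= (rpow x p + rpow y p) / 2.
Proof.
intros Hp Hx Hy.
assert (Hx' := rpow_above_tangent p x ((x + y) / 2) Hp Hx ltac:(lra)).
assert (Hy' := rpow_above_tangent p y ((x + y) / 2) Hp Hy ltac:(lra)).
nra.
Qed.

Lemma rpow_superadditive p x y :
  1 <= p -> 0 <= x -> 0 <= y -> rpow x p + rpow y p <= rpow (x + y) p.
Proof.
intros Hp Hx Hy.
assert (Hsplit : forall z, 0 <= z -> rpow z p = z * rpow z (p - 1)).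
{ intros z Hz. rewrite <- (rpow_1_r z) at 2 by assumption.
  rewrite <- rpow_plus by assumption. f_equal. ring. }
rewrite !Hsplit by lra.
assert (rpow x (p - 1) <= rpow (x + y) (p - 1)) by (apply rpow_le; lra).
assert (rpow y (p - 1) <= rpow (x + y) (p - 1)) by (apply rpow_le; lra).
nra.
Qed.

(** Bernoulli with exponent 1 / q, applied to x^q. *)
Lemma bernoulli_rpow_concave q x : 0 < q <= 1 -> 0 <= x -> rpow x q <= 1 + q * (x - 1).
Proof.
intros Hq Hx.
assert (Hq' : 1 <= / q) by (rewrite <- Rinv_1; apply Rinv_le_contravar; lra).
assert (B := bernoulli_rpow (/ q) (rpow x q) Hq' (rpow_ge0 _ _)).
rewrite rpow_rpow, Rinv_r, rpow_1_r in B by lra.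
apply (Rmult_le_compat_l q) in B; [| lra].
replace (q * (1 + / q * (rpow x q - 1))) with (q + (rpow x q - 1)) in B by (field; lra).
lra.
Qed.

Lemma rpow_below_tangent q x c :
  0 < q <= 1 -> 0 <= x -> 0 < c -> rpow x q <= rpow c q * (1 + q * (x / c - 1)).
Proof.
intros Hq Hx Hc.
assert (B := bernoulli_rpow_concave q (x / c) Hq (Rdiv_le_0_compat _ _ Hx Hc)).
apply (Rmult_le_compat_l (rpow c q)) in B; [| apply rpow_ge0].
rewrite <- rpow_mult in B by (try lra; now apply Rdiv_le_0_compat).
replace (c * (x / c)) with x in B by (field; lra). exact B.
Qed.

Lemma rpow_concave q x y t :
  0 < q <= 1 -> 0 <= x -> 0 <= y -> 0 <= t <= 1 ->
  t * rpow x q + (1 - t) * rpow y q <= rpow (t * x + (1 - t) * y) q.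
Proof.
intros Hq Hx Hy Ht.
assert (Hz : 0 <= t * x + (1 - t) * y) by nra.
destruct Hz as [Hz | Hz].
- set (z := t * x + (1 - t) * y) in *.
  assert (Hx' := rpow_below_tangent q x z Hq Hx Hz).
  assert (Hy' := rpow_below_tangent q y z Hq Hy Hz).
  apply (Rmult_le_compat_l t) in Hx'; [| lra].
  apply (Rmult_le_compat_l (1 - t)) in Hy'; [| lra].
  replace (rpow z q) with (t * (rpow z q * (1 + q * (x / z - 1))) +
                           (1 - t) * (rpow z q * (1 + q * (y / z - 1)))).
  + lra.
  + transitivity (rpow z q * (1 + q * ((t * x + (1 - t) * y) / z - 1))); [field; lra |].
    fold z. field. lra.
- assert (Hx' : t * x = 0) by nra. assert (Hy' : (1 - t) * y = 0) by nra.
  rewrite <- Hz, rpow_0.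
  apply Rmult_integral in Hx'. apply Rmult_integral in Hy'.
  destruct Hx' as [E | E]; destruct Hy' as [E' | E'];
    try rewrite E; try rewrite E'; rewrite ?rpow_0; lra.
Qed.

(** Spreading two arguments apart symmetrically lowers the sum of a concave function.
    With s = |m|^2 + |d|^2 this reduces the complex two-point inequality to the
    case in which m and d are real multiples of each other. *)
Lemma rpow_concave_spread q s t u :
  0 < q <= 1 -> Rabs t <= u -> u <= s ->
  rpow (s + u) q + rpow (s - u) q <= rpow (s + t) q + rpow (s - t) q.
Proof.
intros Hq Ht Hu.
assert (Hu0 := Rle_trans _ _ _ (Rabs_pos t) Ht).
apply Rabs_le_between in Ht.
destruct Hu0 as [Hu0 | <-].
- assert (Hl : 0 <= (u + t) / (2 * u) <= 1).
  { split; [apply Rdiv_le_0_compat; lra |].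
    apply Rmult_le_reg_r with (2 * u); [lra |].
    replace ((u + t) / (2 * u) * (2 * u)) with (u + t) by (field; lra). lra. }
  assert (H1 := rpow_concave q (s + u) (s - u) _ Hq ltac:(lra) ltac:(lra) Hl).
  assert (H2 := rpow_concave q (s - u) (s + u) _ Hq ltac:(lra) ltac:(lra) Hl).
  replace ((u + t) / (2 * u) * (s + u) + (1 - (u + t) / (2 * u)) * (s - u))
    with (s + t) in H1 by (field; lra).
  replace ((u + t) / (2 * u) * (s - u) + (1 - (u + t) / (2 * u)) * (s + u))
    with (s - t) in H2 by (field; lra).
  lra.
- replace t with 0 by lra. lra.
Qed.

Lemma nondecreasing_of_derive (f df : R -> R) (b : R) :
  (forall x, 0 <= x <= b -> is_derive f x (df x)) ->
  (forall x, 0 <= x <= b -> 0 <= df x) ->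
  0 <= b -> f 0 <= f b.
Proof.
intros Hd Hp Hb.
destruct (MVT_gen f 0 b df) as (c & Hc & E).
- rewrite Rmin_left, Rmax_right by assumption. intros; apply Hd; lra.
- rewrite Rmin_left, Rmax_right by assumption. intros x Hx.
  apply continuity_pt_filterlim. apply (ex_derive_continuous (V := R_NormedModule)).
  eexists. now apply Hd.
- rewrite Rmin_left, Rmax_right in Hc by assumption.
  specialize (Hp c Hc). nra.
Qed.

(** By the arithmetic-geometric mean inequality x y <= 1; hence the logarithms of the
    two terms have nonnegative sum. *)
Lemma Rpower_sum_ge_2 a x y : 0 <= a -> 0 < x -> 0 < y -> x + y = 2 ->
  2 <= Rpower x (- a) + Rpower y (- a).
Proof.
intros Ha Hx Hy Hxy.
assert (Hln : ln x + ln y <= 0).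
{ rewrite <- ln_mult, <- ln_1 by assumption.
  assert (Hle : x * y <= 1) 
    by (replace y with (2 - x) by lra; assert (0 <= (x - 1) ^ 2) by apply pow2_ge_0; lra).
  destruct Hle as [Hlt | ->]; [| lra].
  apply Rlt_le, ln_increasing; [now apply Rmult_lt_0_compat | assumption]. }
unfold Rpower.
assert (H1 := exp_ineq1_le (- a * ln x)). assert (H2 := exp_ineq1_le (- a * ln y)).
nra.
Qed.

(** The difference of the two sides vanishes to first order at 0 and its second derivative
    is p (p - 1) ((1 + t)^(p-2) + (1 - t)^(p-2) - 2), which is nonnegative. *)
Lemma binomial_lower_bound_open p t :
  1 <= p <= 2 -> 0 <= t < 1 ->
  2 + p * (p - 1) * t ^ 2 <= rpow (1 + t) p + rpow (1 - t) p.
Proof.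
intros Hp Ht. rewrite !rpow_Rpower by lra.
assert (H1 : forall x, 0 <= x <= t ->
  0 <= p * (Rpower (1 + x) (p - 1) - Rpower (1 - x) (p - 1)) - 2 * p * (p - 1) * x).
{ intros x Hx.
  assert (H := nondecreasing_of_derive
    (fun x => p * (Rpower (1 + x) (p - 1) - Rpower (1 - x) (p - 1)) - 2 * p * (p - 1) * x)
    (fun x => p * (p - 1) * (Rpower (1 + x) (- (2 - p)) + Rpower (1 - x) (- (2 - p)) - 2)) x).
  cbv beta in H.
  replace (p * (Rpower (1 + 0) (p - 1) - Rpower (1 - 0) (p - 1)) - 2 * p * (p - 1) * 0)
    with 0 in H by (rewrite Rplus_0_r, Rminus_0_r; ring).
  apply H; clear H; [| | lra]; intros y Hy.
  - unfold Rpower. auto_derive; [repeat split; lra |]. change (1 + - y) with (1 - y).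
    replace (- (2 - p) * ln (1 + y)) with ((p - 1) * ln (1 + y) + - ln (1 + y)) by ring.
    replace (- (2 - p) * ln (1 - y)) with ((p - 1) * ln (1 - y) + - ln (1 - y)) by ring.
    rewrite !exp_plus, !exp_Ropp, !exp_ln by lra.
    field. lra.
  - assert (Hs := Rpower_sum_ge_2 (2 - p) (1 + y) (1 - y) ltac:(lra) ltac:(lra) ltac:(lra)
                    ltac:(ring)).
    apply Rmult_le_pos; [apply Rmult_le_pos; lra | lra]. }
assert (H := nondecreasing_of_derive
   (fun x => Rpower (1 + x) p + Rpower (1 - x) p - p * (p - 1) * x ^ 2)
   (fun x => p * (Rpower (1 + x) (p - 1) - Rpower (1 - x) (p - 1)) - 2 * p * (p - 1) * x) t).
cbv beta in H.
replace (Rpower (1 + 0) p + Rpower (1 - 0) p - p * (p - 1) * 0 ^ 2) with 2 in H.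
2: { rewrite Rplus_0_r, Rminus_0_r. unfold Rpower. rewrite ln_1, Rmult_0_r, exp_0. ring. }
enough (2 <= Rpower (1 + t) p + Rpower (1 - t) p - p * (p - 1) * t ^ 2) by lra.
apply H; clear H; [| exact H1 | lra]. intros y Hy.
unfold Rpower. auto_derive; [repeat split; lra |]. change (1 + - y) with (1 - y).
replace ((p - 1) * ln (1 + y)) with (p * ln (1 + y) + - ln (1 + y)) by ring.
replace ((p - 1) * ln (1 - y)) with (p * ln (1 - y) + - ln (1 - y)) by ring.
rewrite !exp_plus, !exp_Ropp, !exp_ln by lra. simpl. field. lra.
Qed.

(** The endpoint t = 1, where the second derivative is unbounded for p < 2, is
    reached by continuity. *)
Lemma binomial_lower_bound p t :
  1 <= p <= 2 -> 0 <= t <= 1 ->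
  2 + p * (p - 1) * t ^ 2 <= rpow (1 + t) p + rpow (1 - t) p.
Proof.
intros Hp [Ht0 [Ht | ->]]; [now apply binomial_lower_bound_open |].
set (h := fun t => rpow (Rabs (1 + t)) p + rpow (Rabs (1 - t)) p - (2 + p * (p - 1) * (t * t))).
assert (Hh : forall t, 0 <= t < 1 -> 0 <= h t).
{ intros t Ht. unfold h. rewrite !Rabs_pos_eq by lra.
  assert (B := binomial_lower_bound_open p t Hp Ht). simpl in B. lra. }
assert (Hc : continuous h 1).
{ unfold h. apply (continuous_minus (V := R_NormedModule)).
  - apply (continuous_plus (V := R_NormedModule)).
    + apply (continuous_comp (fun t => 1 + t) (fun u => rpow (Rabs u) p)).
      * apply (continuous_plus (V := R_NormedModule)); [apply continuous_const | apply continuous_id].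
      * apply continuous_rpow_Rabs; lra.
    + apply (continuous_comp (fun t => 1 - t) (fun u => rpow (Rabs u) p)).
      * apply (continuous_minus (V := R_NormedModule)); [apply continuous_const | apply continuous_id].
      * apply continuous_rpow_Rabs; lra.
  - apply (ex_derive_continuous (V := R_NormedModule) (fun t => 2 + p * (p - 1) * (t * t))).
    auto_derive. exact I. }
enough (0 <= h 1).
{ unfold h in H. rewrite !Rabs_pos_eq in H by lra. lra. }
apply Rnot_lt_le. intro Hneg.
assert (Hpos : 0 < - h 1) by lra.
destruct (proj1 (filterlim_locally _ _) Hc (mkposreal _ Hpos)) as [delta Hdelta].
assert (Hm : 0 < Rmin delta 1) by (apply Rmin_glb_lt; [apply cond_pos | lra]).
assert (M1 := Rmin_l delta 1). assert (M2 := Rmin_r delta 1).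
specialize (Hdelta (1 - Rmin delta 1 / 2)).
specialize (Hh (1 - Rmin delta 1 / 2) ltac:(lra)).
assert (B : Rabs (h (1 - Rmin delta 1 / 2) - h 1) < - h 1).
{ apply Hdelta. change (Rabs (1 - Rmin delta 1 / 2 - 1) < delta).
  rewrite Rabs_left1; lra. }
apply Rabs_lt_between in B. lra.
Qed.

(** The constant p - 1 is what the second-order terms in y / x allow: the left side is
    at most x^p (1 + (p/2) (p - 1) (y/x)^2) by concavity. *)
Lemma two_point_real p x y :
  1 < p <= 2 -> 0 <= y <= x ->
  rpow (x ^ 2 + (p - 1) * y ^ 2) (p / 2) <= (rpow (x + y) p + rpow (x - y) p) / 2.
Proof.
intros Hp Hxy.
destruct (Req_dec x 0) as [-> | Hx].
{ replace y with 0 by lra.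
  replace (0 ^ 2 + (p - 1) * 0 ^ 2) with 0 by ring. rewrite Rplus_0_r, Rminus_0_r, !rpow_0. lra. }
assert (Hx0 : 0 < x) by lra.
set (t := y / x).
assert (Ht : 0 <= t <= 1).
{ split; [apply Rdiv_le_0_compat; lra |].
  apply Rmult_le_reg_r with x; [assumption |]. unfold t. field_simplify; lra. }
replace (x ^ 2 + (p - 1) * y ^ 2) with (x ^ 2 * (1 + (p - 1) * t ^ 2)) by (unfold t; field; lra).
replace (x + y) with (x * (1 + t)) by (unfold t; field; lra).
replace (x - y) with (x * (1 - t)) by (unfold t; field; lra).
rewrite !rpow_mult by nra.
replace (rpow (x ^ 2) (p / 2)) with (rpow x p).
2: { rewrite <- (rpow_2 x), rpow_rpow by lra. f_equal. field. }
assert (B := binomial_lower_bound p t ltac:(lra) Ht).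
assert (B' := bernoulli_rpow_concave (p / 2) (1 + (p - 1) * t ^ 2) ltac:(lra) ltac:(nra)).
assert (H0 := rpow_gt0 x p Hx0).
replace ((rpow x p * rpow (1 + t) p + rpow x p * rpow (1 - t) p) / 2)
  with (rpow x p * ((rpow (1 + t) p + rpow (1 - t) p) / 2)) by field.
apply Rmult_le_compat_l; [lra |]. lra.
Qed.

Lemma Cmod_sqr_parallelogram (a b : C) :
  Cmod (a + b) ^ 2 + Cmod (a - b) ^ 2 = 2 * (Cmod a ^ 2 + Cmod b ^ 2).
Proof.
rewrite !Cmod2_alt. destruct a as [a1 a2], b as [b1 b2].
unfold Re, Im, Cminus, Cplus, Copp; cbn [fst snd]. ring.
Qed.

Lemma rpow_half_sqr x p : 0 <= x -> rpow (x ^ 2) (p / 2) = rpow x p.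
Proof.
intro Hx. rewrite <- (rpow_2 x), rpow_rpow by assumption. f_equal. field.
Qed.

(** Superadditivity of s -> s^(p/2), the parallelogram law, then convexity of
    s -> s^(p/2). *)
Lemma clarkson_pointwise p (m d : C) :
  2 <= p ->
  rpow (Cmod m) p + rpow (Cmod d) p <=
  (rpow (Cmod (m + d)) p + rpow (Cmod (m - d)) p) / 2.
Proof.
intro Hp.
rewrite <- !(rpow_half_sqr (Cmod _)) by apply Cmod_ge_0.
eapply Rle_trans; [apply rpow_superadditive; try lra; apply pow2_ge_0 |].
replace (Cmod m ^ 2 + Cmod d ^ 2) with ((Cmod (m + d) ^ 2 + Cmod (m - d) ^ 2) / 2)
  by (rewrite Cmod_sqr_parallelogram; field).
apply rpow_midpoint_convex; try lra; apply pow2_ge_0.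
Qed.

(** By the parallelogram law |m + d|^2 and |m - d|^2 are s + t and s - t with
    |t| <= 2 |m| |d|.  The extreme case |t| = 2 |m| |d| is the inequality for the
    real numbers |m| and |d|. *)
Lemma two_point_complex p (m d : C) :
  1 < p <= 2 ->
  rpow (Cmod m ^ 2 + (p - 1) * Cmod d ^ 2) (p / 2) <=
  (rpow (Cmod (m + d)) p + rpow (Cmod (m - d)) p) / 2.
Proof.
intro Hp.
assert (Hm := Cmod_ge_0 m). assert (Hd := Cmod_ge_0 d).
set (s := Cmod m ^ 2 + Cmod d ^ 2).
set (t := Cmod (m + d) ^ 2 - s).
assert (Hpl : Cmod (m - d) ^ 2 = s - t).
{ assert (H := Cmod_sqr_parallelogram m d). unfold t, s. lra. }
assert (Ht : Rabs t <= 2 * (Cmod m * Cmod d)).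
{ assert (T1 := Cmod_triangle m d).
  assert (T2 := Cmod_triangle m (- d)). rewrite Cmod_opp in T2.
  change (m + - d)%C with (m - d)%C in T2.
  assert (P1 := Cmod_ge_0 (m + d)). assert (P2 := Cmod_ge_0 (m - d)).
  assert (Cmod (m + d) ^ 2 <= (Cmod m + Cmod d) ^ 2) by (apply pow_incr; lra).
  assert (Cmod (m - d) ^ 2 <= (Cmod m + Cmod d) ^ 2) by (apply pow_incr; lra).
  apply Rabs_le. unfold t, s in *. split; nra. }
assert (B := rpow_concave_spread (p / 2) s t _ ltac:(lra) Ht
               ltac:(unfold s; assert (0 <= (Cmod m - Cmod d) ^ 2) by apply pow2_ge_0; nra)).
rewrite <- !(rpow_half_sqr (Cmod (_ : C))) by apply Cmod_ge_0.
rewrite Hpl. replace (Cmod (m + d) ^ 2) with (s + t) by (unfold t; ring).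
eapply Rle_trans; [| apply Rmult_le_compat_r; [lra | exact B]].
destruct (Rle_dec (Cmod d) (Cmod m)) as [Hle | Hle].
- eapply Rle_trans; [apply two_point_real; lra |].
  apply Req_le. unfold Rdiv. rewrite <- !(rpow_half_sqr (_ + _)), <- !(rpow_half_sqr (_ - _)) by lra.
    do 2 f_equal; f_equal; unfold s; ring.
(* Since p - 1 <= 1, moving the weight p - 1 to the smaller modulus only increases the sum. *)
- apply Rle_trans with (rpow (Cmod d ^ 2 + (p - 1) * Cmod m ^ 2) (p / 2)).
  + apply rpow_le; [lra |].
    assert (Cmod m ^ 2 <= Cmod d ^ 2) by (apply pow_incr; lra).
    assert (0 <= Cmod m ^ 2) by apply pow2_ge_0.
    assert (0 <= Cmod d ^ 2) by apply pow2_ge_0. split; nra.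
  + eapply Rle_trans; [apply two_point_real; lra |].
    apply Req_le. unfold Rdiv. rewrite <- !(rpow_half_sqr (_ + _)), <- !(rpow_half_sqr (_ - _)) by lra.
    do 2 f_equal; f_equal; unfold s; ring.
Qed.

(** * Uniform convexity of averages over a circle *)

Definition circle_avg (u : R -> R) : R := / (2 * PI) * RInt u 0 (2 * PI).

Lemma ex_RInt_of_continuous (u : R -> R) a b :
  (forall t, continuous u t) -> ex_RInt u a b.
Proof.
intro Hu. apply (ex_RInt_continuous (V := R_CompleteNormedModule)). intros; apply Hu.
Qed.

Lemma inv_2PI_gt0 : 0 < / (2 * PI).
Proof. apply Rinv_0_lt_compat. generalize PI_RGT_0; lra. Qed.

Lemma circle_avg_le u v :
  (forall t, continuous u t) -> (forall t, continuous v t) ->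
  (forall t, u t <= v t) -> circle_avg u <= circle_avg v.
Proof.
intros Hu Hv H. unfold circle_avg.
apply Rmult_le_compat_l; [apply Rlt_le, inv_2PI_gt0 |].
apply RInt_le; auto using ex_RInt_of_continuous.
generalize PI_RGT_0; lra.
Qed.

Lemma circle_avg_const c : circle_avg (fun _ => c) = c.
Proof.
unfold circle_avg. rewrite RInt_const. unfold scal; simpl. unfold mult; simpl.
field. generalize PI_RGT_0; lra.
Qed.

Lemma circle_avg_lin a b u v :
  (forall t, continuous u t) -> (forall t, continuous v t) ->
  circle_avg (fun t => a * u t + b * v t) = a * circle_avg u + b * circle_avg v.
Proof.
intros Hu Hv. unfold circle_avg.
assert (E : RInt (fun t => a * u t + b * v t) 0 (2 * PI)
            = a * RInt u 0 (2 * PI) + b * RInt v 0 (2 * PI)).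
{ transitivity (plus (RInt (fun t => scal a (u t)) 0 (2 * PI))
                     (RInt (fun t => scal b (v t)) 0 (2 * PI))).
  - apply (RInt_plus (V := R_CompleteNormedModule) (fun t => scal a (u t)) (fun t => scal b (v t)));
      apply (ex_RInt_scal (V := R_NormedModule)); now apply ex_RInt_of_continuous.
  - rewrite !(RInt_scal (V := R_CompleteNormedModule)) by now apply ex_RInt_of_continuous.
    reflexivity. }
rewrite E. ring.
Qed.

Lemma continuous_lin a b u v (t : R) :
  continuous u t -> continuous v t -> continuous (fun t => a * u t + b * v t) t.
Proof.
intros Hu Hv. apply (continuous_plus (V := R_NormedModule)
  (fun t => scal a (u t)) (fun t => scal b (v t)));
now apply (continuous_scal_r (V := R_NormedModule)).
Qed.

Lemma continuous_fst_C (z : C) : continuous fst z.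
Proof.
rewrite (surjective_pairing z).
exact (continuous_fst (U := R_UniformSpace) (V := R_UniformSpace) _ _).
Qed.

Lemma continuous_snd_C (z : C) : continuous snd z.
Proof.
rewrite (surjective_pairing z).
exact (continuous_snd (U := R_UniformSpace) (V := R_UniformSpace) _ _).
Qed.

Lemma continuous_Cmod (z : C) : continuous Cmod z.
Proof.
apply (continuous_ext (fun z : C => sqrt (plus (mult (fst z) (fst z)) (mult (snd z) (snd z))))).
{ intros [x y]. unfold Cmod; simpl. f_equal. unfold plus, mult; simpl. ring. }
assert (H1 := continuous_fst_C z). assert (H2 := continuous_snd_C z).
apply (continuous_comp (fun z : C => plus (mult (fst z) (fst z)) (mult (snd z) (snd z))) sqrt).
- apply (continuous_plus (V := R_NormedModule)); now apply (continuous_mult (K := R_AbsRing)).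
- apply continuous_sqrt.
Qed.

Lemma continuous_Cmod_rpow {U : UniformSpace} (h : U -> C) p x :
  0 < p -> continuous h x -> continuous (fun t => rpow (Cmod (h t)) p) x.
Proof.
intros Hp Hh.
apply (continuous_ext (fun t => rpow (Rabs (Cmod (h t))) p)).
{ intro t. now rewrite Rabs_pos_eq by apply Cmod_ge_0. }
apply (continuous_comp (fun t => Cmod (h t)) (fun u => rpow (Rabs u) p)).
- apply (continuous_comp h Cmod); [assumption | apply continuous_Cmod].
- now apply continuous_rpow_Rabs.
Qed.

Lemma continuous_sqr_sum_rpow k p (m d : R -> C) (t : R) :
  0 < p -> 0 <= k -> continuous m t -> continuous d t ->
  continuous (fun t => rpow (Cmod (m t) ^ 2 + k * Cmod (d t) ^ 2) (p / 2)) t.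
Proof.
intros Hp Hk Hm Hd. apply (continuous_ext
  (fun t => rpow (Rabs (1 * rpow (Cmod (m t)) 2 + k * rpow (Cmod (d t)) 2)) (p / 2))).
- intro u. rewrite !rpow_2 by apply Cmod_ge_0. rewrite Rmult_1_l, Rabs_pos_eq; [reflexivity |].
  assert (X := pow2_ge_0 (Cmod (m u))). assert (Y := pow2_ge_0 (Cmod (d u))). nra.
- apply (continuous_comp (fun t => 1 * rpow (Cmod (m t)) 2 + k * rpow (Cmod (d t)) 2)
           (fun u => rpow (Rabs u) (p / 2))).
  + apply continuous_lin; apply continuous_Cmod_rpow; auto; lra.
  + apply continuous_rpow_Rabs; lra.
Qed.

Definition Lp_mean (p : R) (h : R -> C) : R := circle_avg (fun t => rpow (Cmod (h t)) p).

Lemma Lp_mean_ge0 p h : 0 < p -> (forall t, continuous h t) -> 0 <= Lp_mean p h.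
Proof.
intros Hp Hh. rewrite <- (circle_avg_const 0). apply circle_avg_le.
- intro; apply continuous_const.
- intro; now apply continuous_Cmod_rpow.
- intro; apply rpow_ge0.
Qed.

Lemma continuous_Cplus {U : UniformSpace} (a b : U -> C) x :
  continuous a x -> continuous b x -> continuous (fun t => a t + b t)%C x.
Proof. apply (continuous_plus (V := C_R_NormedModule)). Qed.

Lemma continuous_Cminus {U : UniformSpace} (a b : U -> C) x :
  continuous a x -> continuous b x -> continuous (fun t => a t - b t)%C x.
Proof. apply (continuous_minus (V := C_R_NormedModule)). Qed.

(** The constant kappa in the uniform convexity inequality; it is related to the
    Pythagorean constant by K1 = kappa / (2^(r-1) - 1). *)
Definition convexity_const (p : R) : R := if Rle_dec p 2 then p - 1 else 1.

(** Hölder's inequality for two terms with weights 1 and k, read as the tangent plane of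
    the convex homogeneous function (x, y) -> (x^s + k y^s)^(1/s) at (a, b).  It follows
    from the one-variable tangents of u -> u^s at l a and l b, where l rescales (a, b)
    to the level set through (x, y). *)
Lemma l_power_sum_tangent s k a b x y :
  1 <= s -> 0 <= k -> 0 <= a -> 0 <= b -> 0 <= x -> 0 <= y ->
  0 < rpow a s + k * rpow b s ->
  rpow a (s - 1) * x + k * (rpow b (s - 1) * y) <=
  rpow (rpow a s + k * rpow b s) (1 - / s) * rpow (rpow x s + k * rpow y s) (/ s).
Proof.
intros Hs Hk Ha Hb Hx Hy HW.
set (W := rpow a s + k * rpow b s) in *.
set (Z := rpow x s + k * rpow y s).
assert (HZ : 0 <= Z).
{ unfold Z. assert (X := rpow_ge0 x s). assert (Y := rpow_ge0 y s). nra. }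
assert (Hpow : forall c, 0 <= c -> rpow c s = rpow c (s - 1) * c).
{ intros c Hc. rewrite <- (rpow_1_r c) at 3 by assumption.
  rewrite <- rpow_plus by assumption. f_equal. ring. }
destruct HZ as [HZ | HZ].
(* l^s W = Z: the point (l a, l b) has the same value of x^s + k y^s as (x, y). *)
- set (l := rpow (Z / W) (/ s)).
  assert (Hq : 0 < Z / W) by (apply Rdiv_lt_0_compat; assumption).
  assert (Hl : 0 < l) by now apply rpow_gt0.
  assert (Hls : rpow l s * W = Z).
  { unfold l. rewrite rpow_rpow, Rinv_l, rpow_1_r by lra. field. lra. }
  assert (Tx := rpow_above_tangent s x (l * a) Hs Hx ltac:(nra)).
  assert (Ty := rpow_above_tangent s y (l * b) Hs Hy ltac:(nra)).
  rewrite !rpow_mult in Tx by lra. rewrite !rpow_mult in Ty by lra.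
  apply (Rmult_le_compat_l k) in Ty; [| assumption].
  assert (Hsum : s * rpow l (s - 1) * (rpow a (s - 1) * x + k * (rpow b (s - 1) * y))
                 <= s * (rpow l s * W)).
  { assert (E : rpow l s * W
      + s * rpow l (s - 1) * (rpow a (s - 1) * x + k * (rpow b (s - 1) * y))
      - s * (rpow l s * W) <= Z).
    { unfold Z. eapply Rle_trans; [| apply Rplus_le_compat; [exact Tx | exact Ty]].
      apply Req_le. unfold W. rewrite (Hpow l), (Hpow a), (Hpow b) by lra. ring. }
    lra. }
  rewrite (Hpow l) in Hsum by lra.
  assert (Hl1 := rpow_gt0 l (s - 1) Hl).
  replace (rpow W (1 - / s) * rpow Z (/ s)) with (l * W).
  + apply Rmult_le_reg_l with (s * rpow l (s - 1)); [apply Rmult_lt_0_compat; lra |].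
    eapply Rle_trans; [exact Hsum |]. apply Req_le. ring.
  + replace (rpow Z (/ s)) with (rpow (Z / W * W) (/ s)) by (f_equal; field; lra).
    rewrite rpow_mult by lra. fold l.
    transitivity (l * (rpow W (1 - / s) * rpow W (/ s))); [| ring].
    rewrite <- rpow_plus by lra. replace (1 - / s + / s) with 1 by ring.
    rewrite rpow_1_r; lra.
- assert (X := rpow_ge0 x s). assert (Y := rpow_ge0 y s).
  assert (HX : rpow x s = 0) by (unfold Z in HZ; nra).
  assert (HY : k * rpow y s = 0) by (unfold Z in HZ; nra).
  assert (Hz : forall c, 0 <= c -> rpow c s = 0 -> c = 0).
  { intros c [Hc | <-] E; [| reflexivity]. generalize (rpow_gt0 c s Hc). lra. }
  rewrite <- HZ, rpow_0, (Hz x Hx HX).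
  apply Rmult_integral in HY. destruct HY as [-> | HY]; [lra |].
  rewrite (Hz y Hy HY). lra.
Qed.

(** Minkowski's inequality is reversed in L^(p/2) because p / 2 <= 1.  The right side
    is an average of (x^s + k y^s)^(1/s) with x = |m|^p, y = |d|^p, s = 2 / p; integrating its
    tangent plane at the averages of x and y gives the value there as a lower bound. *)
Lemma reverse_minkowski p k (m d : R -> C) :
  0 < p <= 2 -> 0 <= k ->
  (forall t, continuous m t) -> (forall t, continuous d t) ->
  rpow (Lp_mean p m) (2 / p) + k * rpow (Lp_mean p d) (2 / p) <=
  rpow (circle_avg (fun t => rpow (Cmod (m t) ^ 2 + k * Cmod (d t) ^ 2) (p / 2))) (2 / p).
Proof.
intros Hp Hk Hm Hd.
set (s := 2 / p).
assert (Hs : 1 <= s).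
{ unfold s. apply Rmult_le_reg_r with p; [lra |]. field_simplify; lra. }
assert (Hsi : / s = p / 2) by (unfold s; field; lra).
assert (HA := Lp_mean_ge0 p m ltac:(lra) Hm). assert (HB := Lp_mean_ge0 p d ltac:(lra) Hd).
set (A := Lp_mean p m) in *. set (B := Lp_mean p d) in *.
set (W := rpow A s + k * rpow B s).
assert (HW : 0 <= W).
{ unfold W. assert (X := rpow_ge0 A s). assert (Y := rpow_ge0 B s). nra. }
destruct HW as [HW | HW]; [| rewrite <- HW; apply rpow_ge0].
assert (Cm : forall t, continuous (fun t => rpow (Cmod (m t)) p) t)
  by (intro; apply continuous_Cmod_rpow; auto; lra).
assert (Cd : forall t, continuous (fun t => rpow (Cmod (d t)) p) t)
  by (intro; apply continuous_Cmod_rpow; auto; lra).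
assert (Csum := fun t => continuous_sqr_sum_rpow k p m d t ltac:(lra) Hk (Hm t) (Hd t)).
set (G := circle_avg _).
assert (Hlin : rpow A (s - 1) * A + (k * rpow B (s - 1)) * B <= rpow W (1 - / s) * G).
{ unfold A at 2, B at 2, Lp_mean. rewrite <- circle_avg_lin by assumption.
  replace (rpow W (1 - / s) * G) with
    (rpow W (1 - / s) * G + 0 * circle_avg (fun _ => 0)) by ring.
  unfold G. rewrite <- circle_avg_lin by (intros; try apply continuous_const; auto).
  apply circle_avg_le.
  - intro t; now apply continuous_lin.
  - intro t; apply continuous_lin; [apply Csum | apply continuous_const].
  - intro t.
    assert (T := l_power_sum_tangent s k A B (rpow (Cmod (m t)) p) (rpow (Cmod (d t)) p)
      Hs Hk HA HB (rpow_ge0 _ _) (rpow_ge0 _ _) HW).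
    fold W in T. rewrite !rpow_rpow in T by apply Cmod_ge_0.
    replace (p * s) with 2 in T by (unfold s; field; lra).
    rewrite !rpow_2 in T by apply Cmod_ge_0.
    rewrite <- Hsi. lra. }
assert (Hpow : forall c, 0 <= c -> rpow c (s - 1) * c = rpow c s).
{ intros c Hc. rewrite <- (rpow_1_r c) at 2 by assumption.
  rewrite <- rpow_plus by assumption. f_equal. ring. }
rewrite Rmult_assoc, !Hpow in Hlin by assumption. fold W in Hlin.
assert (HG : rpow W (/ s) <= G).
{ apply Rmult_le_reg_l with (rpow W (1 - / s)); [now apply rpow_gt0 |].
  rewrite <- rpow_plus by lra. replace (1 - / s + / s) with 1 by ring.
  rewrite rpow_1_r; lra. }
replace W with (rpow (rpow W (/ s)) s)
  by (rewrite rpow_rpow, Rinv_l, rpow_1_r; lra).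
apply rpow_le; [lra | split; [apply rpow_ge0 | assumption]].
Qed.

(** For p <= 2 this is 2-uniform convexity with constant p - 1: the two-point inequality is
    integrated, the reverse Minkowski inequality separates m from d, and convexity of
    u -> u^(2/p) separates m + d from m - d.  For p >= 2 it is Clarkson's inequality,
    which holds pointwise because r = p makes the outer power trivial. *)
Theorem Lp_uniform_convexity p (m d : R -> C) :
  1 < p -> (forall t, continuous m t) -> (forall t, continuous d t) ->
  rpow (Lp_mean p m) (lower_r p / p)
    + convexity_const p * rpow (Lp_mean p d) (lower_r p / p) <=
  (rpow (Lp_mean p (fun t => m t + d t)%C) (lower_r p / p)
   + rpow (Lp_mean p (fun t => m t - d t)%C) (lower_r p / p)) / 2.
Proof.
intros Hp Hm Hd.
assert (Hmd : forall t, continuous (fun t => m t + d t)%C t)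
  by (intro; now apply continuous_Cplus).
assert (Hmd' : forall t, continuous (fun t => m t - d t)%C t)
  by (intro; now apply continuous_Cminus).
assert (P1 := Lp_mean_ge0 p m ltac:(lra) Hm). assert (P2 := Lp_mean_ge0 p d ltac:(lra) Hd).
assert (P3 := Lp_mean_ge0 p _ ltac:(lra) Hmd). assert (P4 := Lp_mean_ge0 p _ ltac:(lra) Hmd').
assert (Cp : forall h : R -> C, (forall t, continuous h t) ->
   forall t, continuous (fun t => rpow (Cmod (h t)) p) t)
  by (intros; apply continuous_Cmod_rpow; auto; lra).
assert (Hhalf : forall a b, (a + b) / 2 = / 2 * a + / 2 * b) by (intros; field).
unfold lower_r, convexity_const. destruct (Rle_dec p 2) as [Hp2 | Hp2].
- set (s := 2 / p).
  assert (Hs : 1 <= s).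
  { unfold s. apply Rmult_le_reg_r with p; [lra |]. field_simplify; lra. }
  eapply Rle_trans; [apply reverse_minkowski; auto; lra |]. fold s.
  eapply Rle_trans; [| apply rpow_midpoint_convex; assumption].
  apply rpow_le; [lra |].
  assert (Csum := fun t => continuous_sqr_sum_rpow (p - 1) p m d t ltac:(lra) ltac:(lra)
                             (Hm t) (Hd t)).
  split.
  + rewrite <- (circle_avg_const 0). apply circle_avg_le; auto.
    * intro; apply continuous_const.
    * intro; apply rpow_ge0.
  + rewrite Hhalf. unfold Lp_mean. rewrite <- circle_avg_lin by (now apply Cp).
    apply circle_avg_le; auto.
    * intro t. apply continuous_lin; now apply Cp.
    * intro t. rewrite <- Hhalf. apply two_point_complex; lra.
- replace (p / p) with 1 by (field; lra). rewrite !rpow_1_r by assumption.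
  rewrite Hhalf. replace (Lp_mean p m) with (1 * Lp_mean p m) by ring.
  unfold Lp_mean. rewrite <- !circle_avg_lin by (now apply Cp).
  apply circle_avg_le.
  + intro t. apply continuous_lin; now apply Cp.
  + intro t. apply continuous_lin; now apply Cp.
  + intro t. rewrite <- Hhalf, !Rmult_1_l. apply clarkson_pointwise; lra.
Qed.

(** * Growth of circle means with the radius *)

Lemma continuous_pair {U V W : UniformSpace} (f : U -> V) (g : U -> W) (x : U) :
  continuous f x -> continuous g x -> continuous (fun u => (f u, g u)) x.
Proof.
intros Hf Hg. apply (continuous_comp_2 f g pair); [assumption | assumption |].
apply (continuous_ext (fun z : V * W => z)); [now intros [] | apply continuous_id].
Qed.

Lemma continuous_cpolar (rho : R) (t : R) : continuous (cpolar rho) t.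
Proof.
apply (continuous_pair (fun t => rho * cos t) (fun t => rho * sin t)).
- apply (continuous_scal_r (V := R_NormedModule) rho cos), continuous_cos.
- apply (continuous_scal_r (V := R_NormedModule) rho sin), continuous_sin.
Qed.

(** Jensen's inequality for the mean value property: |w|^p lies above its tangent at |c|
    composed with w -> Re (conj c * w) / |c|, which is linear in w, so that only real parts of
    holomorphic functions have to be averaged. *)
Lemma submean_unit_circle p (g : C -> C) :
  1 <= p -> (forall z, Cmod z <= 1 -> exists d, complex_diff g z d) ->
  rpow (Cmod (g (RtoC 0))) p <= Lp_mean p (fun t => g (cpolar 1 t)).
Proof.
intros Hp Hg.
assert (Hcont : forall t, continuous (fun t => g (cpolar 1 t)) t).
{ intro t. apply (continuous_comp (cpolar 1) g); [apply continuous_cpolar |].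
  destruct (Hg (cpolar 1 t)) as [d Hd]; [rewrite Cmod_cpolar, Rabs_R1; lra |].
  exact (complex_diff_continuous _ _ _ Hd). }
set (c := g (RtoC 0)).
destruct (Cmod_ge_0 c) as [Hc | Hc].
2: { rewrite <- Hc, rpow_0. apply Lp_mean_ge0; [lra | assumption]. }
set (u := fun t => fst (Cconj c * g (cpolar 1 t))%C).
assert (Hu : forall t, continuous u t).
{ intro t. unfold u.
  apply (continuous_ext (fun t => fst c * fst (g (cpolar 1 t)) + snd c * snd (g (cpolar 1 t)))).
  { intro y. simpl. ring. }
  apply continuous_lin.
  - exact (continuous_comp (fun t => g (cpolar 1 t)) fst t (Hcont t) (continuous_fst_C _)).
  - exact (continuous_comp (fun t => g (cpolar 1 t)) snd t (Hcont t) (continuous_snd_C _)). }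
assert (Hmean : circle_avg u = Cmod c ^ 2).
{ unfold circle_avg, u.
  rewrite (mean_value_unit_circle (fun z => Cconj c * g z)%C).
  - fold c. rewrite Cmod2_alt. unfold Re, Im. simpl.
    field. generalize PI_RGT_0; lra.
  - intros z Hz. destruct (Hg z Hz) as [d Hd]. exists (Cconj c * d)%C.
    now apply complex_diff_scal. }
set (k := p * rpow (Cmod c) (p - 1)).
assert (Hk : 0 <= k) by (apply Rmult_le_pos; [lra | apply rpow_ge0]).
apply Rle_trans with
  (* The average of the tangent: as u averages to |c|^2, the terms in k cancel. *)
  (circle_avg (fun t => (k / Cmod c) * u t + 1 * (rpow (Cmod c) p - k * Cmod c))).
- rewrite (circle_avg_lin (k / Cmod c) 1 u (fun _ => rpow (Cmod c) p - k * Cmod c));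
    [| assumption | intro; apply continuous_const].
  rewrite circle_avg_const, Hmean. apply Req_le. field. lra.
- apply circle_avg_le.
  + intro t. apply continuous_lin; [apply Hu | apply continuous_const].
  + intro t. apply continuous_Cmod_rpow; [lra | apply Hcont].
  + intro t.
    assert (T := rpow_above_tangent p (Cmod (g (cpolar 1 t))) (Cmod c) Hp
                   (Cmod_ge_0 _) (Cmod_ge_0 _)).
    fold k in T.
    assert (B : u t <= Cmod c * Cmod (g (cpolar 1 t))).
    { unfold u. eapply Rle_trans; [apply Rle_abs |].
      eapply Rle_trans; [apply re_le_Cmod |]. rewrite Cmod_mult, Cmod_conj. lra. }
    eapply Rle_trans; [| exact T].
    assert (B' : k / Cmod c * u t <= k / Cmod c * (Cmod c * Cmod (g (cpolar 1 t)))).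
    { apply Rmult_le_compat_l; [| exact B]. apply Rdiv_le_0_compat; assumption. }
    replace (k / Cmod c * (Cmod c * Cmod (g (cpolar 1 t))))
      with (k * Cmod (g (cpolar 1 t))) in B' by (field; lra).
    lra.
Qed.

Lemma continuous_slices (G : R -> R -> R) x y :
  continuity_2d_pt G x y ->
  continuous (fun t => G t y) x /\ continuous (fun t => G x t) y.
Proof.
intro H. apply continuity_2d_pt_filterlim in H. split.
- exact (continuous_comp_2 (fun t : R => t) (fun _ => y) G x
           (continuous_id _) (continuous_const _ _) H).
- exact (continuous_comp_2 (fun _ => x) (fun t : R => t) G y
           (continuous_const _ _) (continuous_id _) H).
Qed.

(** Uniform continuity on the compact interval of integration. *)
Lemma continuous_RInt_param (G : R -> R -> R) (a b y : R) :
  (forall x y, continuity_2d_pt G x y) ->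
  continuous (fun y => RInt (fun x => G x y) a b) y.
Proof.
intro HG.
assert (Hex : forall a b y, ex_RInt (fun x => G x y) a b).
{ intros a' b' z. apply ex_RInt_of_continuous. intro t. now apply continuous_slices. }
assert (Hordered : forall a b, a <= b -> continuous (fun y => RInt (fun x => G x y) a b) y).
{ clear a b. intros a b Hab. apply filterlim_locally. intro eps.
  assert (He : 0 < eps / (b - a + 1)) by (apply Rdiv_lt_0_compat; [apply cond_pos | lra]).
  destruct (uniform_continuity_2d_1d G a b y (fun x _ => HG x y) (mkposreal _ He))
    as [delta Hd].
  exists delta. intros z Hz. change (Rabs (z - y) < delta) in Hz.
  assert (Hdelta := cond_pos delta).
  change (Rabs (RInt (fun x => G x z) a b - RInt (fun x => G x y) a b) < eps).
  rewrite <- RInt_sub by apply Hex.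
  eapply Rle_lt_trans.
  - apply (abs_RInt_le_const (fun x => G x z - G x y) a b (eps / (b - a + 1)) Hab).
    + apply (ex_RInt_minus (V := R_NormedModule)); apply Hex.
    + intros t Ht. apply Rabs_lt_between in Hz.
      apply Rlt_le, (Hd t y t z); try lra. rewrite Rminus_diag, Rabs_R0. apply cond_pos.
  - apply Rlt_le_trans with ((b - a + 1) * (eps / (b - a + 1))).
    + apply Rmult_lt_compat_r; lra.
    + apply Req_le. field. lra. }
destruct (Rle_dec a b) as [Hab | Hab]; [now apply Hordered |].
apply (continuous_ext (fun y => opp (RInt (fun x => G x y) b a))).
- intro z. apply (opp_RInt_swap (V := R_CompleteNormedModule)), Hex.
- apply (continuous_opp (V := R_NormedModule)), Hordered. lra.
Qed.

(** This is the form in which Fubini's theorem is used.  As functions of the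
    upper limit of the x-integral, both sides vanish at 0 and their derivatives are
    ordered by hypothesis, so the iterated integrals never have to be compared directly. *)
Lemma RInt_le_swapped (v : R -> R) (G : R -> R -> R) (a b : R) :
  0 <= a -> 0 <= b ->
  (forall x, continuous v x) -> (forall x y, continuity_2d_pt G x y) ->
  (forall x, v x <= RInt (fun y => G x y) 0 b) ->
  RInt v 0 a <= RInt (fun y => RInt (fun x => G x y) 0 a) 0 b.
Proof.
intros Ha Hb Hv HG Hle.
assert (Hslice : forall x y, continuous (fun t => G t y) x)
  by (intros; now apply continuous_slices).
assert (HdI : forall x y, is_derive (fun u => RInt (fun t => G t y) 0 u) x (G x y)).
{ intros x y. apply (is_derive_RInt (V := R_NormedModule) (fun t => G t y) _ 0).
  - apply filter_forall. intro u.
    apply (RInt_correct (V := R_CompleteNormedModule)), ex_RInt_of_continuous.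
    intro; apply Hslice.
  - apply Hslice. }
assert (HD : forall x, is_derive
  (fun x => RInt (fun y => RInt (fun t => G t y) 0 x) 0 b) x (RInt (fun y => G x y) 0 b)).
{ intro x.
  replace (RInt (fun y => G x y) 0 b)
    with (RInt (fun y => Derive (fun u => RInt (fun t => G t y) 0 u) x) 0 b).
  2: { apply RInt_ext. intros y _. apply is_derive_unique, HdI. }
  apply (is_derive_RInt_param (fun u y => RInt (fun t => G t y) 0 u)).
  - apply filter_forall. intros u y _. exists (G u y). apply HdI.
  - intros y _. apply (continuity_2d_pt_ext G); [| apply HG].
    intros u z. symmetry. apply is_derive_unique, HdI.
  - apply filter_forall. intro u. apply ex_RInt_of_continuous. intro y.
    now apply continuous_RInt_param. }
assert (H := nondecreasing_of_derive
  (fun x => RInt (fun y => RInt (fun t => G t y) 0 x) 0 b - RInt v 0 x)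
  (fun x => RInt (fun y => G x y) 0 b - v x) a).
cbv beta in H.
rewrite (RInt_ext (fun y => RInt (fun t => G t y) 0 0) (fun _ => 0)) in H
  by (intros; apply (RInt_point (V := R_CompleteNormedModule))).
rewrite RInt_const, RInt_point in H.
change (scal (b - 0) 0) with ((b - 0) * 0) in H. change zero with 0 in H.
rewrite Rmult_0_r, Rminus_0_r in H.
enough (0 <= RInt (fun y => RInt (fun t => G t y) 0 a) 0 b - RInt v 0 a) by lra.
apply H; clear H; [| | assumption].
- intros x Hx. apply (is_derive_minus (V := R_NormedModule)); [apply HD |].
  apply (is_derive_RInt (V := R_NormedModule) v _ 0); [| apply Hv].
  apply filter_forall. intro u.
    apply (RInt_correct (V := R_CompleteNormedModule)), ex_RInt_of_continuous, Hv.
- intros x Hx. specialize (Hle x). lra.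
Qed.

Lemma RInt_periodic_shift (u : R -> R) (T alpha : R) :
  (forall t, continuous u t) -> (forall t, u (t + T) = u t) ->
  RInt (fun t => u (t + alpha)) 0 T = RInt u 0 T.
Proof.
intros Hu Hper.
assert (Hshift : forall a b c, RInt (fun t => u (t + c)) a b = RInt u (a + c) (b + c)).
{ intros a b c.
  replace (a + c) with (1 * a + c) by ring. replace (b + c) with (1 * b + c) by ring.
  rewrite <- (RInt_comp_lin (V := R_CompleteNormedModule)) by now apply ex_RInt_of_continuous.
  apply RInt_ext. intros x _. change (u (x + c) = 1 * u (1 * x + c)).
  now rewrite !Rmult_1_l. }
assert (Hch : forall a b c, RInt u a b + RInt u b c = RInt u a c).
{ intros a b c. apply (RInt_Chasles (V := R_CompleteNormedModule));
    now apply ex_RInt_of_continuous. }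
rewrite Hshift, Rplus_0_l.
assert (E : RInt u T (T + alpha) = RInt u 0 alpha).
{ rewrite <- (RInt_ext (fun t => u (t + T)) u 0 alpha) by (intros; apply Hper).
  rewrite Hshift, Rplus_0_l. f_equal. ring. }
assert (H1 := Hch 0 alpha (T + alpha)). assert (H2 := Hch 0 T (T + alpha)). lra.
Qed.

Lemma unimodular_cpolar (m : C) : Cmod m = 1 -> exists alpha, m = cpolar 1 alpha.
Proof.
intro Hm. assert (H2 : fst m ^ 2 + snd m ^ 2 = 1).
{ assert (E := Cmod2_alt m). unfold Re, Im in E. rewrite Hm in E. lra. }
destruct m as [x y]; cbn [fst snd] in H2.
assert (Hx : -1 <= x <= 1) by (assert (0 <= y ^ 2) by apply pow2_ge_0; nra).
assert (Hs : 1 - x² = y²) by (unfold Rsqr; lra).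
destruct (Rle_dec 0 y) as [Hy | Hy].
- exists (acos x). unfold cpolar. rewrite cos_acos, sin_acos, Hs, sqrt_Rsqr by assumption.
  now rewrite !Rmult_1_l.
- exists (- acos x). unfold cpolar.
  rewrite cos_neg, sin_neg, cos_acos, sin_acos, Hs by assumption.
  rewrite Rsqr_neg, sqrt_Rsqr by lra. f_equal; ring.
Qed.

Lemma cpolar_mult r s t u : (cpolar r t * cpolar s u)%C = cpolar (r * s) (t + u).
Proof. unfold cpolar, Cmult; cbn [fst snd]. rewrite cos_plus, sin_plus. f_equal; ring. Qed.

(** The disk automorphism sending 0 to r. *)
Definition moebius (r : R) (z : C) : C := ((z + RtoC r) / (1 + RtoC r * z))%C.

Lemma moebius_denominator r z : 0 <= r < 1 -> Cmod z <= 1 -> (1 + RtoC r * z)%C <> RtoC 0.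
Proof.
intros Hr Hz E.
assert (T := Cmod_triangle (1 + RtoC r * z) (- (RtoC r * z))).
replace (1 + RtoC r * z + - (RtoC r * z))%C with (RtoC 1) in T by ring.
rewrite E, Cmod_0, Cmod_1, Cmod_opp, Cmod_mult, Cmod_R, Rabs_pos_eq in T by lra.
assert (P := Cmod_ge_0 z). nra.
Qed.

Lemma moebius_sqr_gap r z :
  Cmod (1 + RtoC r * z) ^ 2 - Cmod (z + RtoC r) ^ 2 = (1 - r ^ 2) * (1 - Cmod z ^ 2).
Proof. rewrite !Cmod2_alt. destruct z as [x y]. simpl. ring. Qed.

Lemma moebius_maps_disk r z : 0 <= r < 1 -> Cmod z <= 1 -> Cmod (moebius r z) <= 1.
Proof.
intros Hr Hz. unfold moebius. assert (Hd := moebius_denominator r z Hr Hz).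
rewrite Cmod_div by assumption. apply Cmod_gt_0 in Hd.
apply Rmult_le_reg_r with (Cmod (1 + RtoC r * z)); [assumption |].
unfold Rdiv. rewrite Rmult_assoc, Rinv_l, Rmult_1_r, Rmult_1_l by lra.
assert (G := moebius_sqr_gap r z).
assert (P := Cmod_ge_0 z). assert (Q := Cmod_ge_0 (z + RtoC r)).
assert (0 <= (1 - r ^ 2) * (1 - Cmod z ^ 2)) by (apply Rmult_le_pos; nra).
apply Rsqr_incr_0_var; unfold Rsqr; lra.
Qed.

Lemma moebius_maps_circle r z : 0 <= r < 1 -> Cmod z = 1 -> Cmod (moebius r z) = 1.
Proof.
intros Hr Hz. unfold moebius. assert (Hd := moebius_denominator r z Hr ltac:(lra)).
rewrite Cmod_div by assumption. apply Cmod_gt_0 in Hd.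
assert (G := moebius_sqr_gap r z). rewrite Hz in G.
assert (Q := Cmod_ge_0 (z + RtoC r)).
replace (Cmod (z + RtoC r)) with (Cmod (1 + RtoC r * z)).
- field. lra.
- apply Rsqr_inj; unfold Rsqr; lra.
Qed.

(** Away from the pole, moebius r v = 1/r + (r - 1/r) / (1 + r v): an affine function of
    the inverse of an affine function.  This is where r <> 0 is needed. *)
Lemma complex_diff_moebius r z :
  0 < r < 1 -> Cmod z <= 1 -> exists d, complex_diff (moebius r) z d.
Proof.
intros Hr Hz. assert (Hd := moebius_denominator r z ltac:(lra) Hz).
assert (Hr0 : RtoC r <> RtoC 0) by (intro E; apply RtoC_inj in E; lra).
assert (H1 := complex_diff_affine 1 (RtoC r) _ z _ (complex_diff_id z)).
assert (H2 := complex_diff_comp Cinv _ z _ _ H1 (complex_diff_inv _ Hd)).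
assert (H3 := complex_diff_affine (/ RtoC r) (RtoC r - / RtoC r) _ z _ H2).
eexists. intros eps Heps. destruct (H3 eps Heps) as (delta & Hdelta & L).
assert (Hd' := proj1 (Cmod_gt_0 _) Hd).
(* Within this distance of z the denominator cannot vanish, as r < 1. *)
exists (Rmin delta (Cmod (1 + RtoC r * z))). split; [now apply Rmin_glb_lt |].
intros w Hw.
assert (W1 := Rlt_le_trans _ _ _ Hw (Rmin_l _ _)).
assert (W2 := Rlt_le_trans _ _ _ Hw (Rmin_r _ _)).
assert (Hdw : (1 + RtoC r * w)%C <> RtoC 0).
{ intro E. replace (1 + RtoC r * z)%C with (1 + RtoC r * w - RtoC r * (w - z))%C in W2 by ring.
  rewrite E in W2. replace (0 - RtoC r * (w - z))%C with (- (RtoC r * (w - z)))%C in W2 by ring.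
  rewrite Cmod_opp, Cmod_mult, Cmod_R, Rabs_pos_eq in W2 by lra.
  assert (P := Cmod_ge_0 (w - z)). nra. }
assert (Hfrac : forall v, (1 + RtoC r * v)%C <> RtoC 0 ->
  moebius r v = (/ RtoC r + (RtoC r - / RtoC r) * / (1 + RtoC r * v))%C).
{ intros v Hv. unfold moebius. field. split; assumption. }
rewrite (Hfrac w), (Hfrac z) by assumption. exact (L w W1).
Qed.

Definition analytic_on_disk (f : C -> C) : Prop :=
  forall z, Cmod z < 1 -> exists d, complex_diff f z d.

Lemma analytic_comp_scaled_moebius f sigma t r z :
  analytic_on_disk f -> 0 <= sigma < 1 -> 0 < r < 1 -> Cmod z <= 1 ->
  exists d, complex_diff (fun z => f (cpolar sigma t * moebius r z)%C) z d.
Proof.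
intros Hf HR Hr Hz.
destruct (complex_diff_moebius r z Hr Hz) as [dm Hm].
apply (complex_diff_scal (cpolar sigma t)) in Hm.
assert (Hin : Cmod (cpolar sigma t * moebius r z) < 1).
{ rewrite Cmod_mult, Cmod_cpolar, Rabs_pos_eq by lra.
  assert (B := moebius_maps_disk r z ltac:(lra) Hz). assert (P := Cmod_ge_0 (moebius r z)). nra. }
destruct (Hf _ Hin) as [df Hdf].
eexists. exact (complex_diff_comp f _ z _ _ Hm Hdf).
Qed.

Lemma analytic_continuous f z : analytic_on_disk f -> Cmod z < 1 -> continuous f z.
Proof. intros Hf Hz. destruct (Hf z Hz) as [d Hd]. exact (complex_diff_continuous _ _ _ Hd). Qed.

Lemma analytic_continuous_circle f rho t :
  analytic_on_disk f -> 0 <= rho < 1 -> continuous (fun t => f (cpolar rho t)) t.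
Proof.
intros Hf Hr. apply (continuous_comp (cpolar rho) f); [apply continuous_cpolar |].
apply analytic_continuous; [assumption |]. rewrite Cmod_cpolar, Rabs_pos_eq; lra.
Qed.

Lemma submean_Hardy p f sigma :
  1 <= p -> analytic_on_disk f -> 0 <= sigma < 1 ->
  rpow (Cmod (f (RtoC 0))) p <= Hardy_mean p f sigma.
Proof.
intros Hp Hf HR.
assert (H := submean_unit_circle p (fun z => f (RtoC sigma * z)%C) Hp).
cbv beta in H. rewrite Cmult_0_r in H.
eapply Rle_trans; [apply H |].
- intros z Hz. assert (Hid := complex_diff_scal (RtoC sigma) _ z _ (complex_diff_id z)).
  destruct (Hf (RtoC sigma * z)%C) as [d Hd].
  { rewrite Cmod_mult, Cmod_R, Rabs_pos_eq by lra.
    assert (P := Cmod_ge_0 z). nra. }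
  eexists. exact (complex_diff_comp f _ z _ _ Hid Hd).
- apply Req_le. unfold Lp_mean, circle_avg, Hardy_mean. f_equal.
  apply RInt_ext. intros t _. do 3 f_equal.
  unfold cpolar, Cmult, RtoC; cbn [fst snd]. f_equal; ring.
Qed.

Lemma continuous_Cmult {U : UniformSpace} (a b : U -> C) x :
  continuous a x -> continuous b x -> continuous (fun t => a t * b t)%C x.
Proof.
intros Ha Hb.
assert (A1 := continuous_comp a fst x Ha (continuous_fst_C _)).
assert (A2 := continuous_comp a snd x Ha (continuous_snd_C _)).
assert (B1 := continuous_comp b fst x Hb (continuous_fst_C _)).
assert (B2 := continuous_comp b snd x Hb (continuous_snd_C _)).
apply (continuous_pair (fun t => fst (a t) * fst (b t) - snd (a t) * snd (b t))
                       (fun t => fst (a t) * snd (b t) + snd (a t) * fst (b t))).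
- apply (continuous_minus (V := R_NormedModule)); now apply (continuous_mult (K := R_AbsRing)).
- apply (continuous_plus (V := R_NormedModule)); now apply (continuous_mult (K := R_AbsRing)).
Qed.

(** Put r = rho / sigma.  For each t the function z -> f(sigma e^(it) moebius r z) takes the value
    f(rho e^(it)) at 0, so |f(rho e^(it))|^p is at most the average over theta of
    |f(sigma e^(it) m(theta))|^p with |m(theta)| = 1.  After integration in t the inner
    integral is the p-th mean on the circle of radius sigma, whatever the rotation
    m(theta).  The Möbius map thus replaces the Poisson kernel. *)
Theorem Hardy_mean_nondecreasing p f rho sigma :
  1 <= p -> analytic_on_disk f -> 0 <= rho <= sigma -> sigma < 1 ->
  Hardy_mean p f rho <= Hardy_mean p f sigma.
Proof.
intros Hp Hf [Hrho HrhoR] HR.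
assert (HPI := PI_RGT_0).
destruct HrhoR as [HrhoR | ->]; [| apply Rle_refl].
destruct Hrho as [Hrho | <-].
2: { eapply Rle_trans; [| apply (submean_Hardy p f sigma Hp Hf); lra].
  apply Req_le. unfold Hardy_mean.
  rewrite (RInt_ext _ (fun _ => rpow (Cmod (f (RtoC 0))) p)).
  - apply (circle_avg_const (rpow (Cmod (f (RtoC 0))) p)).
  - intros t _. do 3 f_equal. unfold cpolar, RtoC. f_equal; ring. }
set (r := rho / sigma).
assert (Hr : 0 < r < 1).
{ split; [apply Rdiv_lt_0_compat; lra |].
  apply Rmult_lt_reg_r with sigma; [lra |]. unfold r. field_simplify; lra. }
set (u := fun t => rpow (Cmod (f (cpolar sigma t))) p).
assert (Hu : forall t, continuous u t).
{ intro t. apply continuous_Cmod_rpow; [lra |]. apply analytic_continuous_circle; [assumption | lra]. }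
set (G := fun t theta => rpow (Cmod (f (cpolar sigma t * moebius r (cpolar 1 theta))%C)) p).
assert (Hcirc : forall theta, Cmod (moebius r (cpolar 1 theta)) = 1).
{ intro theta. apply moebius_maps_circle; [lra |]. rewrite Cmod_cpolar, Rabs_R1; lra. }
assert (HG : forall t theta, continuity_2d_pt G t theta).
{ intros t theta. apply continuity_2d_pt_filterlim.
  apply (continuous_Cmod_rpow (U := prod_UniformSpace R_UniformSpace R_UniformSpace)
    (fun z : R * R => f (cpolar sigma (fst z) * moebius r (cpolar 1 (snd z)))%C) p (t, theta));
    [lra |].
  apply (continuous_comp (fun z : R * R => (cpolar sigma (fst z) * moebius r (cpolar 1 (snd z)))%C) f).
  - apply continuous_Cmult.
    + apply (continuous_comp fst (cpolar sigma)); [apply continuous_fst | apply continuous_cpolar].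
    + apply (continuous_comp snd (fun s => moebius r (cpolar 1 s))); [apply continuous_snd |].
      apply (continuous_comp (cpolar 1) (moebius r)); [apply continuous_cpolar |].
      destruct (complex_diff_moebius r (cpolar 1 theta) Hr) as [d Hd].
      { rewrite Cmod_cpolar, Rabs_R1; lra. }
      exact (complex_diff_continuous _ _ _ Hd).
  - apply analytic_continuous; [assumption |]. cbn [fst snd].
    rewrite Cmod_mult, Hcirc, Cmod_cpolar, Rabs_pos_eq; lra. }
assert (Hinner : forall theta, RInt (fun t => G t theta) 0 (2 * PI) = RInt u 0 (2 * PI)).
{ intro theta. destruct (unimodular_cpolar _ (Hcirc theta)) as [alpha Ea].
  rewrite <- (RInt_periodic_shift u (2 * PI) alpha Hu).
  - apply RInt_ext. intros t _. unfold G, u. rewrite Ea, cpolar_mult. now rewrite Rmult_1_r.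
  - intro t. unfold u, cpolar.
    now rewrite cos_plus, sin_plus, cos_2PI, sin_2PI, !Rmult_0_r, !Rmult_1_r, Rminus_0_r,
      Rplus_0_r. }
assert (Hpoint : forall t, 2 * PI * rpow (Cmod (f (cpolar rho t))) p <= RInt (fun y => G t y) 0 (2 * PI)).
{ intro t.
  assert (S := submean_unit_circle p (fun z => f (cpolar sigma t * moebius r z)%C) Hp
    (fun z Hz => analytic_comp_scaled_moebius f sigma t r z Hf ltac:(lra) Hr Hz)).
  cbv beta in S.
  replace (cpolar sigma t * moebius r 0)%C with (cpolar rho t) in S.
  - apply (Rmult_le_compat_l (2 * PI)) in S; [| lra].
    eapply Rle_trans; [exact S |]. apply Req_le. unfold Lp_mean, circle_avg, G.
    field. lra.
  - unfold moebius. replace (1 + RtoC r * 0)%C with (RtoC 1) by ring.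
    replace rho with (sigma * r) by (unfold r; field; lra).
    unfold cpolar, Cdiv, Cinv, Cmult, Cplus, RtoC; cbn [fst snd]. f_equal; field. }
assert (Hfin := RInt_le_swapped (fun t => 2 * PI * rpow (Cmod (f (cpolar rho t))) p) G
  (2 * PI) (2 * PI) ltac:(lra) ltac:(lra)).
rewrite (RInt_ext (fun y => RInt (fun x => G x y) 0 (2 * PI)) (fun _ => RInt u 0 (2 * PI))) in Hfin
  by (intros; apply Hinner).
rewrite RInt_const in Hfin.
assert (Hc : forall t, continuous (fun t => rpow (Cmod (f (cpolar rho t))) p) t).
{ intro t. apply continuous_Cmod_rpow; [lra |]. apply analytic_continuous_circle; [assumption | lra]. }
assert (E : RInt (fun t => 2 * PI * rpow (Cmod (f (cpolar rho t))) p) 0 (2 * PI)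
          = 2 * PI * RInt (fun t => rpow (Cmod (f (cpolar rho t))) p) 0 (2 * PI)).
{ apply (RInt_scal (V := R_CompleteNormedModule)
          (fun t => rpow (Cmod (f (cpolar rho t))) p)).
  now apply ex_RInt_of_continuous. }
rewrite E in Hfin.
unfold Hardy_mean. fold u.
apply Rmult_le_compat_l; [apply Rlt_le, inv_2PI_gt0 |].
apply Rmult_le_reg_l with (2 * PI); [lra |].
change (scal (2 * PI - 0) (RInt u 0 (2 * PI))) with ((2 * PI - 0) * RInt u 0 (2 * PI)) in Hfin.
rewrite Rminus_0_r in Hfin. apply Hfin; [| exact HG | exact Hpoint].
intro t. now apply (continuous_scal_r (V := R_NormedModule) (2 * PI)
  (fun t => rpow (Cmod (f (cpolar rho t))) p)).
Qed.

(** * Uniform convexity and the Pythagorean inequality in the Hardy space *)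

(** Membership in H^p, with differentiability in the epsilon-delta form. *)
Definition Hardy (p : R) (h : C -> C) : Prop :=
  analytic_on_disk h /\ is_finite (Hardy_sup p h).

Lemma in_Hp_Hardy p f : in_Hp p f -> Hardy p f.
Proof.
intros [Hd Hs]. split; [| exact Hs]. intros z Hz. now apply ex_derive_complex_diff, Hd.
Qed.

Lemma Hardy_mean_le_sup p h rho :
  is_finite (Hardy_sup p h) -> 0 <= rho < 1 -> Hardy_mean p h rho <= real (Hardy_sup p h).
Proof.
intros Hfin Hr.
destruct (Lub_Rbar_correct (fun m => exists rho, 0 <= rho < 1 /\ m = Hardy_mean p h rho))
  as [Hub _].
specialize (Hub _ (ex_intro _ rho (conj Hr eq_refl))).
fold (Hardy_sup p h) in Hub. rewrite <- Hfin in Hub. exact Hub.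
Qed.

Lemma Hardy_sup_bounded p h M :
  (forall rho, 0 <= rho < 1 -> Hardy_mean p h rho <= M) ->
  is_finite (Hardy_sup p h) /\ real (Hardy_sup p h) <= M.
Proof.
intro HM.
destruct (Lub_Rbar_correct (fun m => exists rho, 0 <= rho < 1 /\ m = Hardy_mean p h rho))
  as [Hub Hlub].
fold (Hardy_sup p h) in Hub, Hlub.
assert (H0 := Hub _ (ex_intro _ 0 (conj (conj (Rle_refl 0) Rlt_0_1) eq_refl))).
assert (H1 : Rbar_le (Hardy_sup p h) (Finite M)).
{ apply Hlub. intros m (rho & Hr & ->). now apply HM. }
destruct (Hardy_sup p h); simpl in *; [| contradiction | contradiction].
split; [reflexivity | exact H1].
Qed.

Lemma Hardy_mean_ge0 p h rho :
  0 < p -> analytic_on_disk h -> 0 <= rho < 1 -> 0 <= Hardy_mean p h rho.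
Proof.
intros Hp Hh Hr. apply (Lp_mean_ge0 p (fun t => h (cpolar rho t)) Hp).
intro t. now apply analytic_continuous_circle.
Qed.

Lemma Hardy_sup_ge0 p h : 0 < p -> Hardy p h -> 0 <= real (Hardy_sup p h).
Proof.
intros Hp [Ha Hf]. eapply Rle_trans; [| apply (Hardy_mean_le_sup p h 0 Hf); lra].
apply Hardy_mean_ge0; try assumption. lra.
Qed.

Lemma rpow_affine_bound p (a b w : C) :
  0 < p ->
  rpow (Cmod (a + b * w)) p <=
  rpow 2 p * rpow (Cmod a) p + rpow 2 p * rpow (Cmod b) p * rpow (Cmod w) p.
Proof.
intro Hp.
assert (T := Cmod_triangle a (b * w)). rewrite Cmod_mult in T.
assert (P1 := Cmod_ge_0 a). assert (P2 := Cmod_ge_0 b). assert (P3 := Cmod_ge_0 w).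
assert (P4 := Cmod_ge_0 (a + b * w)).
assert (P5 : 0 <= Cmod b * Cmod w) by now apply Rmult_le_pos.
rewrite Rmult_assoc, <- !rpow_mult by lra.
assert (Q1 := rpow_ge0 (2 * Cmod a) p). assert (Q2 := rpow_ge0 (2 * (Cmod b * Cmod w)) p).
destruct (Rle_dec (Cmod a) (Cmod b * Cmod w)) as [H | H].
- assert (rpow (Cmod (a + b * w)) p <= rpow (2 * (Cmod b * Cmod w)) p) by (apply rpow_le; lra). lra.
- assert (rpow (Cmod (a + b * w)) p <= rpow (2 * Cmod a) p) by (apply rpow_le; lra). lra.
Qed.

Lemma Hardy_affine p f a b : 0 < p -> Hardy p f -> Hardy p (fun z => a + b * f z)%C.
Proof.
intros Hp [Ha Hf].
assert (Ha' : analytic_on_disk (fun z => a + b * f z)%C).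
{ intros z Hz. destruct (Ha z Hz) as [d Hd]. exists (b * d)%C. now apply complex_diff_affine. }
split; [exact Ha' |].
apply (Hardy_sup_bounded p _
  (rpow 2 p * rpow (Cmod b) p * real (Hardy_sup p f) + 1 * (rpow 2 p * rpow (Cmod a) p))).
intros rho Hr.
assert (Hc : forall h, analytic_on_disk h ->
  forall t, continuous (fun t => rpow (Cmod (h (cpolar rho t))) p) t).
{ intros h Hh t. apply continuous_Cmod_rpow; [assumption |]. now apply analytic_continuous_circle. }
apply Rle_trans with (rpow 2 p * rpow (Cmod b) p * Hardy_mean p f rho
                      + 1 * (rpow 2 p * rpow (Cmod a) p)).
- rewrite <- (circle_avg_const (rpow 2 p * rpow (Cmod a) p)).
  change (Hardy_mean p f rho) with (circle_avg (fun t => rpow (Cmod (f (cpolar rho t))) p)).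
  rewrite <- circle_avg_lin; [| now apply Hc | intro; apply continuous_const].
  apply circle_avg_le.
  + exact (Hc _ Ha').
  + intro t. apply continuous_lin; [exact (Hc _ Ha t) | apply continuous_const].
  + intro t. rewrite Rmult_1_l, Rplus_comm. now apply rpow_affine_bound.
- apply Rplus_le_compat_r, Rmult_le_compat_l.
  + apply Rmult_le_pos; apply rpow_ge0.
  + now apply Hardy_mean_le_sup.
Qed.

(** The r-th power of the norm, the quantity in which Pythagorean inequalities are
    additive. *)
Definition Hardy_energy (p : R) (h : C -> C) : R := rpow (Hp_norm p h) (lower_r p).

Lemma lower_r_gt1 p : 1 < lower_r p.
Proof. unfold lower_r. destruct (Rle_dec p 2); lra. Qed.

Lemma Hardy_energy_sup p h :
  1 < p -> Hardy p h -> Hardy_energy p h = rpow (real (Hardy_sup p h)) (lower_r p / p).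
Proof.
intros Hp Hh. unfold Hardy_energy, Hp_norm.
rewrite rpow_rpow by (apply Hardy_sup_ge0; [lra | assumption]). f_equal. field. lra.
Qed.

Lemma energy_exponent_gt0 p : 1 < p -> 0 < lower_r p / p.
Proof. intro Hp. apply Rdiv_lt_0_compat; [generalize (lower_r_gt1 p) |]; lra. Qed.

Lemma mean_power_le_energy p h rho :
  1 < p -> Hardy p h -> 0 <= rho < 1 ->
  rpow (Hardy_mean p h rho) (lower_r p / p) <= Hardy_energy p h.
Proof.
intros Hp Hh Hr. rewrite Hardy_energy_sup by assumption. destruct Hh as [Ha Hf].
apply rpow_le; [now apply Rlt_le, energy_exponent_gt0 |].
split; [apply Hardy_mean_ge0; auto; lra | now apply Hardy_mean_le_sup].
Qed.

Lemma energy_le_of_mean_powers p h M :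
  1 < p -> Hardy p h ->
  (forall rho, 0 <= rho < 1 -> rpow (Hardy_mean p h rho) (lower_r p / p) <= M) ->
  Hardy_energy p h <= M.
Proof.
intros Hp Hh HM. rewrite Hardy_energy_sup by assumption.
assert (Hs := energy_exponent_gt0 p Hp). set (s := lower_r p / p) in *.
assert (HM0 : 0 <= M).
{ eapply Rle_trans; [apply (rpow_ge0 (Hardy_mean p h 0) s) | apply HM; lra]. }
assert (B : real (Hardy_sup p h) <= rpow M (/ s)).
{ apply Hardy_sup_bounded. intros rho Hr. apply rpow_inv_le; auto.
  apply Hardy_mean_ge0; [lra | apply Hh | assumption]. }
replace M with (rpow (rpow M (/ s)) s) by (rewrite rpow_rpow, Rinv_l, rpow_1_r; lra).
apply rpow_le; [lra |]. split; [apply Hardy_sup_ge0; [lra | assumption] | exact B].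
Qed.

(** On each circle this is the inequality for L^p.  The two terms on the left have to
    be near their suprema simultaneously, which is possible since circle means
    increase with the radius. *)
Theorem Hardy_uniform_convexity p (m d : C -> C) :
  1 < p -> Hardy p m -> Hardy p d ->
  Hardy p (fun z => m z + d z)%C -> Hardy p (fun z => m z - d z)%C ->
  Hardy_energy p m + convexity_const p * Hardy_energy p d <=
  (Hardy_energy p (fun z => m z + d z)%C + Hardy_energy p (fun z => m z - d z)%C) / 2.
Proof.
intros Hp Hm Hd Hs Hdf.
assert (Hk : 0 < convexity_const p) by (unfold convexity_const; destruct (Rle_dec p 2); lra).
set (M := (_ + _) / 2).
assert (Hs0 := Rlt_le _ _ (energy_exponent_gt0 p Hp)).
assert (Hmono : forall h, Hardy p h -> forall rho rho', 0 <= rho <= rho' -> rho' < 1 ->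
  rpow (Hardy_mean p h rho) (lower_r p / p) <= rpow (Hardy_mean p h rho') (lower_r p / p)).
{ intros h [Ha _] rho rho' Hr Hr'. apply rpow_le; [assumption |]. split.
  - apply Hardy_mean_ge0; auto; lra.
  - apply Hardy_mean_nondecreasing; auto; lra. }
assert (Hcircle : forall rho, 0 <= rho < 1 ->
  rpow (Hardy_mean p m rho) (lower_r p / p)
  + convexity_const p * rpow (Hardy_mean p d rho) (lower_r p / p) <= M).
{ intros rho Hr.
  eapply Rle_trans;
    [apply (Lp_uniform_convexity p (fun t => m (cpolar rho t)) (fun t => d (cpolar rho t)) Hp) |].
  - intro t. apply analytic_continuous_circle; [apply Hm | assumption].
  - intro t. apply analytic_continuous_circle; [apply Hd | assumption].
  - assert (E1 := mean_power_le_energy p _ rho Hp Hs Hr).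
    assert (E2 := mean_power_le_energy p _ rho Hp Hdf Hr).
    change (Lp_mean p (fun t => m (cpolar rho t) + d (cpolar rho t))%C)
      with (Hardy_mean p (fun z => m z + d z)%C rho).
    change (Lp_mean p (fun t => m (cpolar rho t) - d (cpolar rho t))%C)
      with (Hardy_mean p (fun z => m z - d z)%C rho).
    unfold M. lra. }
assert (Htwo : forall rho rho', 0 <= rho < 1 -> 0 <= rho' < 1 ->
  rpow (Hardy_mean p m rho) (lower_r p / p)
  + convexity_const p * rpow (Hardy_mean p d rho') (lower_r p / p) <= M).
{ intros rho rho' Hr Hr'.
  assert (L1 := Rmax_l rho rho'). assert (L2 := Rmax_r rho rho').
  assert (L3 : Rmax rho rho' < 1) by (apply Rmax_lub_lt; lra).
  eapply Rle_trans; [| apply (Hcircle (Rmax rho rho')); lra].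
  apply Rplus_le_compat; [apply Hmono; auto; lra |].
  apply Rmult_le_compat_l; [lra | apply Hmono; auto; lra]. }
(* The radii being independent, the two suprema are taken one after the other. *)
enough (Hardy_energy p m <= M - convexity_const p * Hardy_energy p d) by lra.
apply energy_le_of_mean_powers; auto. intros rho Hr.
enough (Hardy_energy p d <=
        (M - rpow (Hardy_mean p m rho) (lower_r p / p)) / convexity_const p).
{ apply (Rmult_le_compat_l (convexity_const p)) in H; [| lra].
  replace (convexity_const p * ((M - rpow (Hardy_mean p m rho) (lower_r p / p)) / convexity_const p))
    with (M - rpow (Hardy_mean p m rho) (lower_r p / p)) in H by (field; lra). lra. }
apply energy_le_of_mean_powers; auto. intros rho' Hr'.
apply Rmult_le_reg_l with (convexity_const p); [assumption |].
specialize (Htwo rho rho' Hr Hr').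
replace (convexity_const p * ((M - rpow (Hardy_mean p m rho) (lower_r p / p)) / convexity_const p))
  with (M - rpow (Hardy_mean p m rho) (lower_r p / p)) by (field; lra). lra.
Qed.

Lemma Hardy_mean_scal p (c : C) h rho :
  0 < p -> analytic_on_disk h -> 0 <= rho < 1 ->
  Hardy_mean p (fun z => c * h z)%C rho = rpow (Cmod c) p * Hardy_mean p h rho.
Proof.
intros Hp Ha Hr.
assert (Hc : forall t, continuous (fun t => rpow (Cmod (h (cpolar rho t))) p) t).
{ intro t. apply continuous_Cmod_rpow; [assumption |]. now apply analytic_continuous_circle. }
assert (E := circle_avg_lin (rpow (Cmod c) p) 0 _ (fun _ => 0) Hc
               (fun t => continuous_const (U := R_UniformSpace) (V := R_UniformSpace) 0 t)).
rewrite circle_avg_const, Rmult_0_r, Rplus_0_r in E.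
refine (eq_trans _ E). unfold Hardy_mean, circle_avg. f_equal. apply RInt_ext.
intros t _. rewrite Cmod_mult, rpow_mult, Rplus_0_r by apply Cmod_ge_0.
reflexivity.
Qed.

Lemma Hardy_energy_ge0 p h : 0 <= Hardy_energy p h.
Proof. apply rpow_ge0. Qed.

Lemma Hardy_energy_scal_ge p (c : C) h :
  1 < p -> Hardy p h -> Hardy p (fun z => c * h z)%C ->
  rpow (Cmod c) (lower_r p) * Hardy_energy p h <= Hardy_energy p (fun z => c * h z)%C.
Proof.
intros Hp Hh Hch.
destruct (Cmod_ge_0 c) as [Hc | Hc].
2: { rewrite <- Hc, rpow_0, Rmult_0_l. apply Hardy_energy_ge0. }
assert (Hcr := rpow_gt0 (Cmod c) (lower_r p) Hc).
apply Rmult_le_reg_l with (/ rpow (Cmod c) (lower_r p)); [now apply Rinv_0_lt_compat |].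
rewrite <- Rmult_assoc, Rinv_l, Rmult_1_l by lra.
apply energy_le_of_mean_powers; auto. intros rho Hr.
apply Rmult_le_reg_l with (rpow (Cmod c) (lower_r p)); [assumption |].
rewrite <- Rmult_assoc, Rinv_r, Rmult_1_l by lra.
eapply Rle_trans; [| apply (mean_power_le_energy p _ rho Hp Hch Hr)].
destruct Hh as [Ha _].
rewrite Hardy_mean_scal by (auto; lra).
assert (P := Hardy_mean_ge0 p h rho ltac:(lra) Ha Hr).
rewrite rpow_mult, rpow_rpow by (try apply rpow_ge0; auto; lra).
apply Req_le. do 2 f_equal. field. lra.
Qed.

(** A function with E(t) >= 2 E(t/2) satisfies E(1) >= 2^n E(2^-n), and the lower bound
    -b t^r makes the right side at least -b 2^(n(1-r)), which tends to 0. *)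
Lemma halving_growth (E : R -> R) (r b : R) :
  1 < r -> 0 <= b ->
  (forall t, 0 < t -> - (b * rpow t r) <= E t) ->
  (forall t, 0 < t -> 2 * E (t / 2) <= E t) ->
  0 <= E 1.
Proof.
intros Hr Hb Hlow Hhalf.
(* q = 2^(1-r), the ratio by which 2^n (2^-n)^r decreases. *)
set (q := rpow (/ 2) (r - 1)).
assert (Hq : 0 < q < 1).
{ split; [apply rpow_gt0; lra |]. unfold q. rewrite rpow_Rpower by lra.
  unfold Rpower. apply Rlt_le_trans with (exp 0); [apply exp_increasing | rewrite exp_0; lra].
  rewrite ln_Rinv by lra. assert (L := ln_lt_2). nra. }
assert (Hiter : forall n, 2 ^ n * E ((/ 2) ^ n) <= E 1).
{ induction n as [|n IH]; [simpl; lra |].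
  eapply Rle_trans; [| exact IH].
  assert (H := Hhalf ((/ 2) ^ n) ltac:(apply pow_lt; lra)).
  replace ((/ 2) ^ n / 2) with ((/ 2) ^ S n) in H by (simpl; field).
  assert (P := pow_lt 2 n ltac:(lra)). simpl pow at 1. nra. }
assert (Hpow : forall n, 2 ^ n * rpow ((/ 2) ^ n) r = q ^ n).
{ induction n as [|n IH]; [simpl; rewrite rpow_1_l; ring |].
  assert (P := pow_le (/ 2) n ltac:(lra)).
  simpl. rewrite rpow_mult by lra. rewrite <- IH.
  replace (rpow (/ 2) r) with (/ 2 * q); [field |].
  unfold q. rewrite <- (rpow_1_r (/ 2)) at 1 by lra. rewrite <- rpow_plus by lra. f_equal. ring. }
assert (Hn : forall n, - (b * q ^ n) <= E 1).
{ intro n. eapply Rle_trans; [| apply (Hiter n)]. rewrite <- Hpow.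
  assert (H := Hlow ((/ 2) ^ n) ltac:(apply pow_lt; lra)).
  assert (P := pow_lt 2 n ltac:(lra)). nra. }
apply Rnot_lt_le. intro Hneg.
destruct (pow_lt_1_zero q ltac:(rewrite Rabs_pos_eq; lra) (- E 1 / (b + 1))
  ltac:(apply Rdiv_lt_0_compat; lra)) as [N HN].
specialize (HN N (Nat.le_refl N)). specialize (Hn N).
assert (P := pow_lt q N ltac:(lra)).
rewrite Rabs_pos_eq in HN by lra.
apply (Rmult_lt_compat_l (b + 1)) in HN; [| lra].
replace ((b + 1) * (- E 1 / (b + 1))) with (- E 1) in HN by (field; lra).
lra.
Qed.

Lemma lower_K1_convexity_const p :
  1 < p -> lower_K1 p * (rpow 2 (lower_r p - 1) - 1) = convexity_const p /\ 0 < lower_K1 p.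
Proof.
intro Hp. unfold lower_K1, lower_r, convexity_const. destruct (Rle_dec p 2).
- replace (2 - 1) with 1 by ring. rewrite rpow_1_r by lra. lra.
- rewrite rpow_Rpower by lra.
  assert (H : 1 < Rpower 2 (p - 1)).
  { apply Rle_lt_trans with (Rpower 2 0); [rewrite Rpower_O; lra | apply Rpower_lt; lra]. }
  split; [field; lra |]. apply Rdiv_lt_0_compat; lra.
Qed.

(** Write D(t) for the energy of x + t y minus that of x.  Uniform convexity at
    the midpoint of x and x + t y gives D(t) >= 2 D(t/2) + 2 kappa (t/2)^r Y with Y the energy of y.  Subtracting
    K1 t^r Y absorbs the last term exactly when K1 (2^(r-1) - 1) = kappa, and
    orthogonality D >= 0 starts the halving argument. *)
Theorem Hardy_pythagorean p (x y : C -> C) :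
  1 < p -> Hardy p y -> (forall t : R, Hardy p (fun z => x z + RtoC t * y z)%C) ->
  (forall t : R, 0 < t -> Hardy_energy p x <= Hardy_energy p (fun z => x z + RtoC t * y z)%C) ->
  Hardy_energy p x + lower_K1 p * Hardy_energy p y <= Hardy_energy p (fun z => x z + y z)%C.
Proof.
intros Hp Hy Hxy Horth.
destruct (lower_K1_convexity_const p Hp) as [HK HK0].
assert (Hr := lower_r_gt1 p). set (r := lower_r p) in *.
set (K := lower_K1 p) in *. set (Y := Hardy_energy p y).
assert (HY : 0 <= Y) by apply Hardy_energy_ge0.
set (phi := fun t : R => Hardy_energy p (fun z => x z + RtoC t * y z)%C).
assert (E1 : Hardy_energy p (fun z => x z + y z)%C = phi 1).
{ unfold phi. f_equal. extensionality z. ring. }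
assert (HX : Hardy p x).
{ replace x with (fun z => x z + RtoC 0 * y z)%C; [apply Hxy |]. extensionality z. ring. }
assert (Hscal : forall t, Hardy p (fun z => RtoC t * y z)%C).
{ intro t. replace (fun z => RtoC t * y z)%C with (fun z => 0 + RtoC t * y z)%C.
  - apply Hardy_affine; [lra | assumption].
  - extensionality z. ring. }
enough (H : 0 <= phi 1 - Hardy_energy p x - K * Y * rpow 1 r).
{ rewrite rpow_1_l in H. rewrite E1. lra. }
apply (halving_growth (fun t => phi t - Hardy_energy p x - K * Y * rpow t r) r (K * Y));
  [assumption | apply Rmult_le_pos; lra | |]; intros t Ht.
- assert (H := Horth t Ht). unfold phi. lra.
- assert (U := Hardy_uniform_convexity p (fun z => x z + RtoC (t / 2) * y z)%C
    (fun z => RtoC (t / 2) * y z)%C Hp (Hxy _) (Hscal _)).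
  cbv beta in U.
  replace (fun z => x z + RtoC (t / 2) * y z + RtoC (t / 2) * y z)%C
    with (fun z => x z + RtoC t * y z)%C in U.
  2: { extensionality z. replace t with (t / 2 + t / 2) at 1 by field. rewrite RtoC_plus. ring. }
  replace (fun z => x z + RtoC (t / 2) * y z - RtoC (t / 2) * y z)%C with x in U
    by (extensionality z; ring).
  specialize (U (Hxy t) HX).
  assert (S := Hardy_energy_scal_ge p (RtoC (t / 2)) y Hp Hy (Hscal _)).
  rewrite Cmod_R, Rabs_pos_eq in S by lra. fold r in S. fold Y in S.
  fold (phi t) in U. fold (phi (t / 2)) in U.
  rewrite <- HK in U.
  assert (H2 : rpow t r = 2 * rpow 2 (r - 1) * rpow (t / 2) r).
  { replace t with (2 * (t / 2)) at 1 by field. rewrite rpow_mult by lra. f_equal.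
    rewrite <- (rpow_1_r 2) at 2 by lra. rewrite <- rpow_plus by lra. f_equal. ring. }
  rewrite H2.
  assert (Hk : 0 < K * (rpow 2 (r - 1) - 1)).
  { rewrite HK. unfold convexity_const; destruct (Rle_dec p 2); lra. }
  apply (Rmult_le_compat_l (K * (rpow 2 (r - 1) - 1))) in S; [| lra].
  lra.
Qed.

Lemma Hardy_energy_const p (c : C) : 1 < p ->
  Hardy p (fun _ => c) /\ Hardy_energy p (fun _ => c) = rpow (Cmod c) (lower_r p).
Proof.
intro Hp.
assert (Hm : forall rho, Hardy_mean p (fun _ => c) rho = rpow (Cmod c) p).
{ intro rho. apply (circle_avg_const (rpow (Cmod c) p)). }
assert (Hh : Hardy p (fun _ => c)).
{ split.
  - intros z _. exists (0 * 1)%C.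
    replace (fun _ : C => c) with (fun w => c + 0 * w)%C by (extensionality w; ring).
    apply complex_diff_affine, complex_diff_id.
  - apply (Hardy_sup_bounded p _ (rpow (Cmod c) p)). intros rho _. rewrite Hm. lra. }
split; [exact Hh |].
assert (E : rpow (rpow (Cmod c) p) (lower_r p / p) = rpow (Cmod c) (lower_r p)).
{ rewrite rpow_rpow by apply Cmod_ge_0. f_equal. field. lra. }
apply Rle_antisym.
- apply energy_le_of_mean_powers; auto. intros rho _. rewrite Hm. lra.
- rewrite <- E, <- (Hm 0). apply mean_power_le_energy; auto. lra.
Qed.

(** This is the orthogonality of constants to functions vanishing at 0. *)
Lemma Hardy_energy_ge_value_at_0 p h :
  1 < p -> Hardy p h -> rpow (Cmod (h (RtoC 0))) (lower_r p) <= Hardy_energy p h.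
Proof.
intros Hp Hh.
eapply Rle_trans; [| apply (mean_power_le_energy p h 0 Hp Hh); lra].
replace (rpow (Cmod (h (RtoC 0))) (lower_r p))
  with (rpow (rpow (Cmod (h (RtoC 0))) p) (lower_r p / p)).
- apply rpow_le; [now apply Rlt_le, energy_exponent_gt0 |].
  split; [apply rpow_ge0 | apply submean_Hardy; try lra; apply Hh].
- rewrite rpow_rpow by apply Cmod_ge_0. f_equal. field. lra.
Qed.

(** * The bound for the optimal constant *)

(** This is the orthogonality of 1 - lambda f to f. *)
Lemma OPA_0_minimizes p f lambda mu :
  1 < p -> is_OPA 0 p f (fun _ => lambda) ->
  Hardy_energy p (fun z => 1 - lambda * f z)%C <= Hardy_energy p (fun z => 1 - mu * f z)%C.
Proof.
intros Hp [_ Hmin]. apply rpow_le; [generalize (lower_r_gt1 p); lra |].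
split; [apply rpow_ge0 |]. apply (Hmin (fun _ => mu)).
exists (fun _ => mu). intro z. rewrite sum_O. simpl. ring.
Qed.

Theorem proposition3p3 (p : R) (f : C -> C) (lambda : C)
  (hp : 1 < p)
  (hf : in_Hp p f)
  (hf0 : f (RtoC 0) <> RtoC 0)
  (hlambda : is_OPA 0 p f (fun _ : C => lambda)) :
  Cmod lambda <=
    1 / (rpow (lower_K1 p) (1 / lower_r p) *
         rpow (rpow (Hp_norm p (fun z : C => Cminus (f z) (f (RtoC 0)))) (lower_r p)
               + rpow (Hp_norm p f) (lower_r p))
              (1 / lower_r p)).
Proof.
apply in_Hp_Hardy in hf.
assert (Haff : forall a b, Hardy p (fun z => a + b * f z)%C)
  by (intros; apply Hardy_affine; [lra | assumption]).
assert (Hr := lower_r_gt1 p).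
destruct (lower_K1_convexity_const p hp) as [_ HK].
set (c := (1 - lambda * f (RtoC 0))%C).
set (g := (fun z => f z - f (RtoC 0))%C).
fold (Hardy_energy p g). fold (Hardy_energy p f).
assert (Hg : Hardy p g).
{ unfold g. replace (fun z => f z - f (RtoC 0))%C with (fun z => - f (RtoC 0) + 1 * f z)%C
    by (extensionality z; ring). apply Haff. }
assert (Hscal : forall (b : C) h, Hardy p h -> Hardy p (fun z => b * h z)%C).
{ intros b h Hh. replace (fun z => b * h z)%C with (fun z => 0 + b * h z)%C
    by (extensionality z; ring). apply Hardy_affine; [lra | assumption]. }
assert (H1 := Hardy_pythagorean p (fun z => 1 - lambda * f z)%C (fun z => lambda * f z)%C hp
  (Hscal _ _ hf)).
cbv beta in H1.
replace (fun z => 1 - lambda * f z + lambda * f z)%C with (fun _ : C => RtoC 1) in H1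
  by (extensionality z; ring).
rewrite (proj2 (Hardy_energy_const p (RtoC 1) hp)), Cmod_1, rpow_1_l in H1.
assert (H2 := Hardy_pythagorean p (fun _ => c) (fun z => - lambda * g z)%C hp (Hscal _ _ Hg)).
cbv beta in H2.
replace (fun z => c + - lambda * g z)%C with (fun z => 1 - lambda * f z)%C in H2
  by (extensionality z; unfold c, g; ring).
assert (Haffx : forall t : R, (fun z => 1 - lambda * f z + RtoC t * (lambda * f z))%C
                  = (fun z => 1 - (lambda - RtoC t * lambda) * f z)%C)
  by (intro t; extensionality z; ring).
assert (B1 : Hardy_energy p (fun z => 1 - lambda * f z)%C
  + lower_K1 p * Hardy_energy p (fun z => lambda * f z)%C <= 1).
{ apply H1; intro t; rewrite Haffx.
  - replace (fun z => 1 - (lambda - RtoC t * lambda) * f z)%C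
      with (fun z => 1 + (RtoC t * lambda - lambda) * f z)%C by (extensionality z; ring).
    apply Haff.
  - intros _. now apply OPA_0_minimizes. }
assert (Hc : forall t : R, Hardy p (fun z => c + RtoC t * (- lambda * g z))%C).
{ intro t. replace (fun z => c + RtoC t * (- lambda * g z))%C
    with (fun z => c + (RtoC t * - lambda) * g z)%C by (extensionality z; ring).
  apply Hardy_affine; [lra | assumption]. }
assert (B2 : Hardy_energy p (fun _ => c) + lower_K1 p * Hardy_energy p (fun z => - lambda * g z)%C
  <= Hardy_energy p (fun z => 1 - lambda * f z)%C).
{ apply H2; [exact Hc |]. intros t _.
  rewrite (proj2 (Hardy_energy_const p c hp)).
  assert (V := Hardy_energy_ge_value_at_0 p _ hp (Hc t)). cbv beta in V.
  replace (c + RtoC t * (- lambda * g (RtoC 0)))%C with c in V by (unfold g; ring). exact V. }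
assert (S1 := Hardy_energy_scal_ge p lambda f hp hf (Hscal _ _ hf)).
assert (S2 := Hardy_energy_scal_ge p (- lambda)%C g hp Hg (Hscal _ _ Hg)).
rewrite Cmod_opp in S2.
assert (P := Hardy_energy_ge0 p (fun _ => c)).
assert (Hmain : rpow (Cmod lambda) (lower_r p)
  * (lower_K1 p * (Hardy_energy p g + Hardy_energy p f)) <= 1).
{ apply (Rmult_le_compat_l (lower_K1 p)) in S1; [| lra].
  apply (Rmult_le_compat_l (lower_K1 p)) in S2; [| lra]. lra. }
assert (Hpos : 0 < Hardy_energy p g + Hardy_energy p f).
{ assert (V := Hardy_energy_ge_value_at_0 p f hp hf).
  assert (V0 := rpow_gt0 (Cmod (f (RtoC 0))) (lower_r p) (proj1 (Cmod_gt_0 _) hf0)).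
  assert (Pg := Hardy_energy_ge0 p g). lra. }
assert (Hl := Cmod_ge_0 lambda).
rewrite <- rpow_mult by lra.
set (T := lower_K1 p * (Hardy_energy p g + Hardy_energy p f)) in *.
assert (HT : 0 < T) by (apply Rmult_lt_0_compat; assumption).
assert (HT' := rpow_gt0 T (1 / lower_r p) HT).
apply Rmult_le_reg_r with (rpow T (1 / lower_r p)); [assumption |].
replace (1 / rpow T (1 / lower_r p) * rpow T (1 / lower_r p)) with 1 by (field; lra).
replace (Cmod lambda * rpow T (1 / lower_r p))
  with (rpow (rpow (Cmod lambda) (lower_r p) * T) (1 / lower_r p)).
- apply Rle_trans with (rpow 1 (1 / lower_r p)); [| rewrite rpow_1_l; lra].
  apply rpow_le.
  + apply Rlt_le, Rdiv_lt_0_compat; lra.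
  + split; [| exact Hmain]. apply Rmult_le_pos; [apply rpow_ge0 | lra].
- rewrite rpow_mult, rpow_rpow by (try apply rpow_ge0; lra).
  replace (lower_r p * (1 / lower_r p)) with 1 by (field; lra). now rewrite rpow_1_r.
Qed.
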